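(* For every integer $r$ with $1\le r\le 9$, $R(P;r)=r+6$.
   Context: A 3-graph is a 3-uniform hypergraph. $P$ denotes the loose 3-uniform path of length three: the 3-graph on 7 vertices $a,b,c,d,e,f,g$ with the 3 edges $\{a,b,c\},\{c,d,e\},\{e,f,g\}$. $K_n$ denotes the complete 3-graph on $n$ vertices (all $\binom n3$ triples are edges). The Ramsey number $R(P;r)$ is the least integer $n$ such that every $r$-coloring of the edges of $K_n$ results in a monochromatic copy of $P$ (a copy being a not necessarily induced sub-3-graph isomorphic to $P$). *)

(* Defs.v *)
From mathcomp Require Import all_boot.

Set Implicit Arguments.
Unset Strict Implicit.
Unset Printing Implicit Defensive.

Record graph3 (V : finType) := Graph3 {
  edges : {set {set V}};
  edges_card3 : {in edges, forall e : {set V}, #|e| = 3}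
}.

(* Not necessarily induced: [H] may have further edges inside the image. *)
Definition has_copy (U V : finType) (F : graph3 U) (H : graph3 V) : Prop :=
  exists2 f : U -> V, injective f
    & forall e : {set U}, e \in edges F -> f @: e \in edges H.

Lemma complete3_card3 (n : nat) :
  {in [set e : {set 'I_n} | #|e| == 3], forall e : {set 'I_n}, #|e| = 3}.
Proof. by move=> e; rewrite inE => /eqP. Qed.

Definition complete3 (n : nat) : graph3 'I_n := Graph3 (@complete3_card3 n).

Definition triple (i j k : nat) : {set 'I_7} :=
  [set inord i; inord j; inord k].

Lemma triple_card3 (i j k : nat) : i < j < k -> k < 7 -> #|triple i j k| = 3.
Proof.
case/andP=> ij jk k7.
have j7 := ltn_trans jk k7; have i7 := ltn_trans ij j7.
rewrite /triple setUC cardsU1 cards2 !inE -!val_eqE /= !inordK //.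
by rewrite (gtn_eqF jk) (gtn_eqF (ltn_trans ij jk)) (ltn_eqF ij).
Qed.

Definition loose_path_edges : {set {set 'I_7}} :=
  [set triple 0 1 2; triple 2 3 4; triple 4 5 6].

Lemma loose_path_card3 :
  {in loose_path_edges, forall e : {set 'I_7}, #|e| = 3}.
Proof. by move=> e; rewrite !inE => /orP[/orP[]|] /eqP->; apply: triple_card3. Qed.

Definition loose_path : graph3 'I_7 := Graph3 loose_path_card3.

Definition edge_of (V : finType) (H : graph3 V) := {e : {set V} | e \in edges H}.

Definition coloring (V : finType) (H : graph3 V) (r : nat) :=
  edge_of H -> 'I_r.

Lemma color_class_card3 (V : finType) (H : graph3 V) (r : nat)
    (c : coloring H r) (i : 'I_r) :
  {in [set val e | e : edge_of H & c e == i], forall e : {set V}, #|e| = 3}.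
Proof. by move=> _ /imsetP[e _ ->]; apply: edges_card3 (valP e). Qed.

Definition color_class (V : finType) (H : graph3 V) (r : nat)
    (c : coloring H r) (i : 'I_r) : graph3 V :=
  Graph3 (@color_class_card3 V H r c i).

Definition arrows (n : nat) (U : finType) (F : graph3 U) (r : nat) : Prop :=
  forall c : coloring (complete3 n) r,
    exists i : 'I_r, has_copy F (color_class c i).

(* [is_ramsey F r N] reads R(F; r) = N. *)
Definition is_ramsey (U : finType) (F : graph3 U) (r N : nat) : Prop :=
  arrows N F r /\ forall n : nat, arrows n F r -> N <= n.

(* Main.v *)
(* Let a triple system be path-free if it contains no loose path of length three.
   For the upper bound, r path-free systems on r + 6 points leave at least 10 - r
   triples uncovered, for r <= 9, by induction on r.  If all edges of some system but
   at most one contain a vertex x, delete x and that system; the one lost triple is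
   paid for by the 10 - r.  Otherwise no system is that close to a star, and counting
   suffices, because a path-free system on n points which is not close to a star is
   either small or split by a 6-set that no edge crosses.  The count only fails for
   two disjoint complete systems on 6 points, when n = 12; then the overlaps of the
   bipartitions into two 6-sets have to be taken into account.

   The structure of a path-free system comes from a maximum matching e_1, ..., e_k
   and the fact that an edge meeting two disjoint edges lies in their union.  Hence
   an edge is either a bridge inside some e_i and e_j together, or it meets a single
   e_i.  The edges of the second kind at a fixed e_i form an intersecting system, and
   traces outside the matching of edges at different e_i are equal or disjoint.
   Bridges are few by a finite search, unless e_i and e_j form a 6-set that no edge
   crosses.

   For the lower bound, colour r + 5 points by r - 1 stars and a complete system on
   the 6 remaining points. *)
Require Import Defs.
From mathcomp Require Import all_boot.
From mathcomp Require Import zify.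

Set Implicit Arguments.
Unset Strict Implicit.
Unset Printing Implicit Defensive.

(** Counting alone cannot succeed: a star on 15 points has 91 triples, while nine systems covering
    all 455 need only about 51 each. A budget that loses one per deleted near-star and is still
    positive at r = 9 is at least 10 - r, which explains the number 10; it appears as
    [10 <= #|uncovered X Hs| + r] to avoid subtraction. Once near-stars are gone, n = r + 6 points
    require r * threshold n + (10 - r) to be at most 'C(n, 3). This is an equality at n = 8 and at n
    = 11, so the bounds on a single system leave little freedom; hence the computed bridge counts
    and the enumeration over all ways of distributing the outside vertices among the matching edges.
    At n = 12 two disjoint complete systems on 6 points have 40 triples, more than 220 / 6. There
    the budget of 4 is met exactly by 220 - 4 = 40 + 32 + 4 * 36: one split system, one small one,
    and four that each add at most 36 new triples. *)

Section PathFree.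
Variable T : finType.
Implicit Types (x y z e f g h : {set T}) (H : {set {set T}}).

Definition is_path x y z :=
  [&& #|x :&: y| == 1, #|y :&: z| == 1 & [disjoint x & z]].

Definition pfree H :=
  [forall x in H, forall y in H, forall z in H, ~~ is_path x y z].

Lemma pfreeP H :
  reflect {in H & &, forall x y z, ~~ is_path x y z} (pfree H).
Proof.
apply: (iffP forall_inP) => [P x y z xH yH zH|P x xH].
  by have /forall_inP/(_ _ yH)/forall_inP/(_ _ zH) := P x xH.
by apply/forall_inP => y yH; apply/forall_inP => z zH; apply: P.
Qed.

Lemma pfreeS H H' : H' \subset H -> pfree H -> pfree H'.
Proof.
move=> /subsetP sub /pfreeP P; apply/pfreeP => x y z xH yH zH.
by apply: P; apply: sub.
Qed.

Lemma card3P x : #|x| = 3 ->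
  exists a b c, uniq [:: a; b; c] /\ x =i [:: a; b; c].
Proof.
move=> cx; have := enum_uniq x; have := mem_enum x; rewrite cardE in cx.
case: (enum x) cx => [|a [|b [|c [|]]]] //= _ E U.
by exists a, b, c; split=> [|i]; [exact: U|rewrite E].
Qed.

Lemma card2P x : #|x| = 2 -> exists a b, a != b /\ x = [set a; b].
Proof. by move/eqP/cards2P => [a [b [ab ->]]]; exists a, b. Qed.

Lemma meetP x y : reflect (exists2 v, v \in x & v \in y) (~~ [disjoint x & y]).
Proof.
rewrite -setI_eq0; apply: (iffP (set0Pn _)) => [[v]|[v vx vy]].
  by rewrite inE => /andP[]; exists v.
by exists v; rewrite inE vx.
Qed.

Lemma disjP x y : reflect (forall v, v \in x -> v \in y -> False) [disjoint x & y].
Proof.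
apply: (iffP idP) => [d v vx vy|P]; first by move/negP: d; apply=> //; apply/negPn/meetP; exists v.
by apply/negPn/meetP => -[v vx vy]; apply: (P v).
Qed.

Lemma disjoint_uniq (s t : seq T) x y : x =i s -> y =i t -> [disjoint x & y] ->
  ~~ has (mem s) t.
Proof.
move=> xs yt /disjP dxy; apply/hasPn => v vt; apply/negP => vs.
by apply: (dxy v); rewrite ?xs ?yt.
Qed.

Lemma uniq_cat3 (s t u : seq T) : uniq s -> uniq t -> uniq u ->
  ~~ has (mem s) t -> ~~ has (mem s) u -> ~~ has (mem t) u -> uniq (s ++ t ++ u).
Proof.
by move=> us ut uu st su tu; rewrite !cat_uniq us ut uu tu has_cat negb_or st su.
Qed.

Lemma card3_with x a : #|x| = 3 -> a \in x ->
  exists b c, uniq [:: a; b; c] /\ x =i [:: a; b; c].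
Proof.
move=> x3 ax; have [b [c [bc E]]] : exists b c, b != c /\ x :\ a = [set b; c].
  by apply: card2P; have := cardsD1 a x; rewrite ax x3; lia.
have /setD1P[ba bx] : b \in x :\ a by rewrite E !inE eqxx.
have /setD1P[ca cx] : c \in x :\ a by rewrite E !inE eqxx orbT.
exists b, c; split; first by rewrite /= !inE negb_or eq_sym ba eq_sym ca bc.
by move=> v; rewrite -(setD1K ax) E !inE.
Qed.

(* An edge meeting two disjoint edges in one vertex each would be the middle of a path. *)
Lemma sub_union_meet H e f h : pfree H -> e \in H -> f \in H -> h \in H ->
  #|h| = 3 -> [disjoint e & f] -> ~~ [disjoint h & e] -> ~~ [disjoint h & f] ->
  h \subset e :|: f.
Proof.
move=> /pfreeP P eH fH hH h3 def me mf.
have := P e h f eH hH fH; rewrite /is_path def andbT setIC.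
rewrite -!setI_eq0 -!cards_eq0 in me mf.
have : #|h :&: e| + #|h :&: f| <= 3.
  rewrite -h3 -cardsUI -setIUr -setIIr.
  move: def; rewrite -setI_eq0 => /eqP ->; rewrite setI0 cards0 addn0.
  by apply: subset_leq_card; apply: subsetIl.
have E : #|h :&: (e :|: f)| = #|h :&: e| + #|h :&: f|.
  rewrite -cardsUI -setIUr -setIIr.
  by move: def; rewrite -setI_eq0 => /eqP ->; rewrite setI0 cards0 addn0.
move=> le N.
have {}E : #|h :&: (e :|: f)| = #|h| by lia.
by apply/setIidPl; apply/eqP; rewrite eqEcard subsetIl E leqnn.
Qed.
End PathFree.

(** Since edges have three vertices, the pattern of intersections in [is_path] forces seven distinct
    vertices; they are named a, ..., g as in the definition of P. *)
Lemma path_copy (V : finType) (G : graph3 V) x y z :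
  x \in edges G -> y \in edges G -> z \in edges G -> is_path x y z ->
  has_copy loose_path G.
Proof.
move=> xG yG zG /and3P[/cards1P[c xy] /cards1P[e yz] dxz].
have x3 := edges_card3 xG; have y3 := edges_card3 yG; have z3 := edges_card3 zG.
have /setIP[cx cy] : c \in x :&: y by rewrite xy set11.
have /setIP[ey ez] : e \in y :&: z by rewrite yz set11.
have ne v w : v \in x -> w \in z -> v != w.
  by move=> vx wz; apply/eqP => vw; move/disjP: dxz => /(_ v vx); apply; rewrite vw.
have yxc v : v \in y -> v \in x -> v = c.
  by move=> vy vx; apply/set1P; rewrite -xy inE vx.
have yze v : v \in y -> v \in z -> v = e.
  by move=> vy vz; apply/set1P; rewrite -yz inE vy.
have [a [b [ab xE]]] : exists a b, a != b /\ x :\ c = [set a; b].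
  by apply/card2P; have := cardsD1 c x; rewrite cx x3; lia.
have [f [g [fg zE]]] : exists a b, a != b /\ z :\ e = [set a; b].
  by apply/card2P; have := cardsD1 e z; rewrite ez z3; lia.
have [d yE] : exists d, y :\ c :\ e = [set d].
  apply/cards1P; have := cardsD1 c y; have := cardsD1 e (y :\ c).
  rewrite !inE cy ey y3 eq_sym ne //; lia.
have /setD1P[ac ax] : a \in x :\ c by rewrite xE !inE eqxx.
have /setD1P[bc bx] : b \in x :\ c by rewrite xE !inE eqxx orbT.
have /setD1P[fe fz] : f \in z :\ e by rewrite zE !inE eqxx.
have /setD1P[ge gz] : g \in z :\ e by rewrite zE !inE eqxx orbT.
have /setD1P[de /setD1P[dc dy]] : d \in y :\ c :\ e by rewrite yE !inE eqxx.
have dnx v : v \in x -> v != d.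
  by move=> vx; apply: contra_neq dc => vd; apply: yxc; rewrite // -vd.
have dnz v : v \in z -> d != v.
  by move=> vz; apply: contra_neq de => vd; apply: yze; rewrite // vd.
pose s := [:: a; b; c; d; e; f; g].
have us : uniq s.
  by rewrite /s /= !inE !negb_or ab ac bc fg de (eq_sym e) fe (eq_sym e) ge (eq_sym c) dc !dnx ?dnz ?ne.
exists (fun i : 'I_7 => nth a s i) => [i j /eqP|E].
  by rewrite nth_uniq // => /eqP/val_inj.
have im i j k : i < 7 -> j < 7 -> k < 7 ->
    [set nth a s (val l) | l in triple i j k] =
    [set nth a s i; nth a s j; nth a s k].
  by move=> i7 j7 k7; rewrite /triple !imsetU !imset_set1 /= !inordK.
rewrite !inE => /orP[/orP[]|] /eqP ->; rewrite im //=.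
- suff -> : [set a; b; c] = x by [].
  by rewrite -(setD1K cx) xE setUC.
- suff -> : [set c; d; e] = y by [].
  by rewrite -(setD1K cy) -(@setD1K _ e (y :\ c)) ?yE ?inE ?ey ?[e == _]eq_sym ?ne // setUAC setUA.
suff -> : [set e; f; g] = z by [].
by rewrite -(setD1K ez) zE setUA.
Qed.

(** * Exhaustive search on labelled triples *)

(* Triples of labels: the label [i] stands for the [i]-th vertex of a fixed
   duplicate-free list. *)
Definition common (c d : seq nat) := count (mem d) c.

Definition label_path (c d e : seq nat) :=
  if common c d == 1 then (common d e == 1) && (common c e == 0) else false.

(** The pair [a], [b] runs over both orders, so [c] is tried as the middle edge and as an end; by
    symmetry of paths one end is enough. *)
Definition clash (S : seq (seq nat)) (c : seq nat) :=
  has (fun a => has (fun b => label_path a b c || label_path a c b) S) S.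

(* Branch and bound: can at most [b] members of [C] be added to [S] without
   creating a path?  Members of [C] clashing with [S] have been removed.
   [vm_compute] evaluates both arguments of [||], hence the conditionals. *)
Fixpoint few (n : nat) (S C : seq (seq nat)) (b : nat) : bool :=
  if size C <= b then true else
  match n, C, b with
  | n'.+1, c :: C', b'.+1 =>
      if few n' S C' b
      then few n' (c :: S) [seq d <- C' | ~~ clash (c :: S) d] b' else false
  | _, _, _ => false
  end.

(** The search starts from the forced members [S]. If they already contain a path, no path-free
    system contains them and any bound holds vacuously. *)
Definition few_compatible (S C : seq (seq nat)) (b : nat) :=
  if has (clash S) S then true else
  let C' := [seq c <- C | ~~ clash S c] in few (size C') S C' b.

(** Increasing lists, so that every 3-subset of the labels is listed only once and the search does
    not count it twice. *)
Definition triples_below (m : nat) : seq (seq nat) :=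
  [seq c <- [seq [:: i; p.1; p.2] | i <- iota 0 m,
              p <- [seq (j, k) | j <- iota 0 m, k <- iota 0 m]] | sorted ltn c].

Lemma mem_triples_below m c :
  c \in triples_below m -> [/\ size c = 3, uniq c & all (fun i => i < m) c].
Proof.
rewrite mem_filter => /andP[so /allpairsP[[i [j k]] /= [im /allpairsP[[j' k'] /= [jm km [? ?]] ]]]].
subst j' k' => E; subst c; move: im jm km so; rewrite !mem_iota /= !inE => im jm km so.
by split=> //; lia.
Qed.

Section Labels.
Variables (T : finType) (v0 : T) (vs : seq T) (H : {set {set T}}).
Hypothesis uvs : uniq vs.

Definition lab (c : seq nat) : {set T} := [set x in map (nth v0 vs) c].

Definition wf (c : seq nat) := uniq c && all (fun i => i < size vs) c.

Lemma mem_lab c i : wf c -> i < size vs -> (nth v0 vs i \in lab c) = (i \in c).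
Proof.
case/andP=> _ /allP al ilt; rewrite inE; apply/mapP/idP => [[j jc E]|ic]; last by exists i.
by move/eqP: E; rewrite nth_uniq // ?al // => /eqP ->.
Qed.

Lemma card_lab c : wf c -> #|lab c| = size c.
Proof.
case/andP=> uc /allP al; rewrite cardsE; have /card_uniqP -> : uniq (map (nth v0 vs) c).
  by rewrite map_inj_in_uniq // => i j ic jc /eqP; rewrite nth_uniq ?al // => /eqP.
by rewrite size_map.
Qed.

Lemma card_labI c d : wf c -> wf d -> #|lab c :&: lab d| = common c d.
Proof.
move=> wc wd; have wf_cd : wf [seq i <- c | i \in d].
  case/andP: wc => uc /allP al; rewrite /wf filter_uniq //=.
  by apply/allP => i; rewrite mem_filter => /andP[_]; apply: al.
rewrite /common -size_filter -(card_lab wf_cd); apply: eq_card => x.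
rewrite inE; apply/andP/idP.
  rewrite inE => -[/mapP[i ic ->]]; case/andP: (wc) => _ /allP al.
  by rewrite !mem_lab ?al // mem_filter ic => ->.
rewrite inE => /mapP[i]; rewrite mem_filter => /andP[id ic ->].
by case/andP: (wc) => _ /allP al; rewrite !mem_lab ?al.
Qed.

Lemma label_pathP c d e : wf c -> wf d -> wf e ->
  is_path (lab c) (lab d) (lab e) = label_path c d e.
Proof.
by move=> wc wd we; rewrite /is_path -setI_eq0 -cards_eq0 !card_labI.
Qed.

Hypothesis Hfree : pfree H.

Let inH c := lab c \in H.

Lemma clashN S c : all wf S -> all inH S -> wf c -> inH c -> ~~ clash S c.
Proof.
move=> /allP wS /allP HS wc cH; apply/hasPn => a aS; apply/hasPn => b bS.
rewrite -!label_pathP ?wc //; try exact: wS; move/pfreeP: Hfree => P.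
have [aH bH] := (HS _ aS, HS _ bS).
by rewrite negb_or !P.
Qed.

Lemma few_count n S C b : all wf S -> all inH S -> all wf C ->
  few n S C b -> count inH C <= b.
Proof.
elim: n S C b => [|n IH] S C b wS HS wC /=.
  by case: ifP => // le _; apply: leq_trans le; apply: count_size.
case: ifP => [le _|_]; first by apply: leq_trans le; apply: count_size.
case: C wC => [|c C] //= /andP[wc wC]; case: b => // b; case: ifP => // no yes.
have [cH|cH] := boolP (inH c); last by rewrite add0n; apply: (IH S).
rewrite add1n ltnS.
have -> : count inH C = count inH [seq d <- C | ~~ clash (c :: S) d].
  rewrite count_filter; apply: eq_in_count => d dC /=.
  have [dH|//] := boolP (inH d); rewrite clashN //= ?wc ?cH //.
  exact: (allP wC).
apply: IH yes; rewrite /= ?wc ?cH //.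
by apply/allP => d; rewrite mem_filter => /andP[_]; apply: (allP wC).
Qed.

Lemma few_compatible_count S C b : all wf S -> all inH S -> all wf C ->
  few_compatible S C b -> count inH C <= b.
Proof.
rewrite /few_compatible => wS HS wC; case: ifP => [/hasP[c cS]|_]; first by rewrite (negPf (clashN _ _ _ _)) ?(allP wS) ?(allP HS).
move/few_count => /(_ wS HS) le; rewrite (leq_trans _ (le _)) //.
  rewrite count_filter; apply/eq_leq/eq_in_count => d dC /=.
  by have [dH|//] := boolP (inH d); rewrite clashN //= (allP wC).
by apply/allP => d; rewrite mem_filter => /andP[_]; apply: (allP wC).
Qed.

Lemma triples_below_wf m : m <= size vs -> all wf (triples_below m).
Proof.
move=> le; apply/allP => c /mem_triples_below[_ uc /allP al]; rewrite /wf uc /=.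
by apply/allP => i /al im; apply: leq_trans le.
Qed.

Lemma sub_lab m (h : {set T}) : m <= size vs -> #|h| = 3 ->
  {subset h <= take m vs} ->
  exists2 c, c \in triples_below m & h = lab c.
Proof.
move=> le h3 sub; pose c := [seq i <- iota 0 m | nth v0 vs i \in h].
have cm i : i \in c -> i < m.
  by rewrite mem_filter mem_iota => /andP[_ /andP[]].
have wc : wf c.
  rewrite /wf filter_uniq ?iota_uniq //=; apply/allP => i /cm im.
  exact: leq_trans le.
have E : h = lab c.
  apply/setP => x; rewrite inE; apply/idP/mapP => [xh|[i]].
    have xv := sub _ xh; set i := index x (take m vs).
    have im : i < m by move: xv; rewrite -index_mem size_takel.
    have ix : nth v0 vs i = x by rewrite -(nth_take _ im) nth_index.
    by exists i; rewrite // mem_filter ix xh mem_iota.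
  by rewrite mem_filter => /andP[xh _] ->.
have s3 : size c = 3 by rewrite -(card_lab wc) -E.
have so : sorted ltn c by apply: sorted_filter; [exact: ltn_trans | exact: iota_ltn_sorted].
exists c => //; rewrite mem_filter so /=.
case: c s3 cm {wc E so} => [|i [|j [|k []]]] //= _ cm.
apply/allpairsP; exists (i, (j, k)); split=> //=; first by rewrite mem_iota cm // inE eqxx.
by apply/allpairsP; exists (j, k); rewrite !mem_iota !cm // !inE eqxx ?orbT.
Qed.

Lemma card_le_count (A : {set {set T}}) C :
  (forall h, h \in A -> h \in H /\ exists2 c, c \in C & h = lab c) ->
  #|A| <= count inH C.
Proof.
move=> P; rewrite -size_filter -(size_map lab); apply: leq_trans (card_size _).
apply/subset_leq_card/subsetP => h /P[hH [c cC E]]; apply/mapP.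
by exists c; rewrite // mem_filter cC andbT /inH -E.
Qed.

End Labels.

Definition label_bridges m d1 d2 :=
  [seq c <- triples_below m | (0 < common c d1) && (0 < common c d2)].

(** * Edges bridging two or three disjoint edges *)

Section Bridges.
Variables (T : finType) (H : {set {set T}}).
Hypothesis Hfree : pfree H.
Hypothesis H3 : {in H, forall h : {set T}, #|h| = 3}.
Implicit Types (e f h x y : {set T}).

Definition bridge e f :=
  [set h in H | ~~ [disjoint h & e] && ~~ [disjoint h & f]].

Lemma bridgeC e f : bridge e f = bridge f e.
Proof. by apply/setP => h; rewrite !inE [X in _ && X]andbC. Qed.

Lemma mem_bridge_sub e f h : e \in H -> f \in H -> [disjoint e & f] ->
  h \in bridge e f -> h \subset e :|: f.
Proof.
move=> eH fH def; rewrite inE => /and3P[hH me mf].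
by apply: (sub_union_meet Hfree) => //; apply: H3.
Qed.

Lemma bridge_lab v0 vs m d1 d2 (e := lab v0 vs d1) (f := lab v0 vs d2) :
  uniq vs -> m <= size vs -> wf vs d1 -> wf vs d2 ->
  all (gtn m) d1 -> all (gtn m) d2 ->
  e \in H -> f \in H -> [disjoint e & f] ->
  forall h, h \in bridge e f ->
  exists2 c, c \in label_bridges m d1 d2 & h = lab v0 vs c.
Proof.
move=> uvs le w1 w2 /allP s1 /allP s2 eH fH def h hb.
have sub : {subset h <= take m vs}.
  move=> x /(subsetP (mem_bridge_sub eH fH def hb)); rewrite !inE.
  have im d : {subset d <= gtn m} -> x \in map (nth v0 vs) d -> x \in take m vs.
    move=> sd /mapP[i /sd im ->]; rewrite -(nth_take v0 im) mem_nth // size_takel //.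
  by case/orP; apply: im.
move: hb; rewrite inE => /and3P[hH].
have [c cm hE] := sub_lab v0 uvs le (H3 hH) sub.
have wc := allP (triples_below_wf le) _ cm.
rewrite hE -!setI_eq0 -!cards_eq0 !card_labI // -!lt0n => m1 m2.
by exists c; rewrite // mem_filter m1 m2.
Qed.

(** Write h = {a, u, v} with [a] in [e]. A bridge g through [a] has two vertices in [f], otherwise
    h, g, f is a path; a bridge g avoiding [a] contains the rest of [e], otherwise h, e, g is a
    path. If a bridge of the first sort meets one of the second sort, they form a path with [h]. At
    most three bridges survive, which the search confirms. *)
Lemma bridge_le3 e f h : e \in H -> f \in H -> h \in H -> [disjoint e & f] ->
  #|h :&: e| = 1 -> [disjoint h & f] -> #|bridge e f| <= 3.
Proof.
move=> eH fH hH def /eqP/cards1P[a ha] dhf.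
have /setIP[ah ae] : a \in h :&: e by rewrite ha set11.
have [b [c [ue Ee]]] := card3_with (H3 eH) ae.
have [u [v [uh Eh]]] := card3_with (H3 hH) ah.
have [f0 [f1 [f2 [uf Ef]]]] := card3P (H3 fH).
(* Labels 0 to 2 are [e], 3 to 5 are [f], and 6, 7 are the rest of [h]. Bridges lie in [e :|: f], so
   the candidates use labels below 6 only. *)
pose vs := [:: a; b; c] ++ [:: f0; f1; f2] ++ [:: u; v].
have onlya w : w \in e -> w \in h -> w = a.
  by move=> we wh; apply/set1P; rewrite -ha inE wh.
have uvs : uniq vs.
  apply: uniq_cat3 => //; first by case/andP: uh => _ /=.
  - exact: disjoint_uniq Ee Ef def.
  - apply/hasPn => w; rewrite !inE => wuv; apply/negP => wabc.
    move: uh; rewrite /= !inE => /andP[/norP[au av] _].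
    have /onlya E : w \in e by rewrite Ee !inE.
    by case/orP: wuv E => /eqP-> E; rewrite E ?Eh ?inE ?eqxx ?orbT // in au av.
  apply/hasPn => w wuv; apply/negP => wf; move/disjP: dhf => /(_ w); apply.
    by rewrite Eh !inE; move: wuv; rewrite !inE => ->; rewrite orbT.
  by rewrite Ef.
have eL : e = lab a vs [:: 0; 1; 2] by apply/setP => w; rewrite inE Ee.
have fL : f = lab a vs [:: 3; 4; 5] by apply/setP => w; rewrite inE Ef.
have hL : h = lab a vs [:: 0; 6; 7] by apply/setP => w; rewrite inE Eh.
rewrite eL fL; apply: leq_trans (_ : count (fun c => lab a vs c \in H)
  (label_bridges 6 [:: 0; 1; 2] [:: 3; 4; 5]) <= _).
  apply: card_le_count => g gb; split; first by move: gb; rewrite inE => /andP[].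
  by apply: bridge_lab gb; rewrite -?eL -?fL.
apply: (few_compatible_count uvs Hfree
  (S := [:: [:: 0; 1; 2]; [:: 3; 4; 5]; [:: 0; 6; 7]])).
- by [].
- by rewrite /= -eL -fL -hL eH fH hH.
- by vm_compute.
by vm_compute.
Qed.

(** Here h = {u, a, b} and e = {a, b, c}. A bridge g with one vertex in [f] and only one of a, b
    would make h, g, f a path. This excludes 6 of the 18 conceivable bridges, and the search brings
    the other 12 down to 9. *)
Lemma bridge_le9_cross2 e f h : e \in H -> f \in H -> h \in H -> [disjoint e & f] ->
  #|h :&: e| = 2 -> [disjoint h & f] -> #|bridge e f| <= 9.
Proof.
move=> eH fH hH def he2 dhf.
have [u [ue' uh']] : exists u, u \notin e /\ u \in h.
  have /card_gt0P[u] : 0 < #|h :\: e| by rewrite cardsD he2 H3.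
  by rewrite inE => /andP[]; exists u.
have [a [b [uh Eh]]] := card3_with (H3 hH) uh'.
have abe : (a \in e) && (b \in e).
  have sub : h :&: e \subset [set a; b].
    apply/subsetP => w; rewrite inE Eh !inE => /andP[/orP[/eqP->|//]].
    by rewrite (negPf ue').
  have ab : #|[set a; b]| <= #|h :&: e| by rewrite he2 cards2; case: eqP.
  have /setP E : h :&: e = [set a; b] by apply/eqP; rewrite eqEcard sub.
  have := E a; have := E b; rewrite !inE !eqxx orbT /=.
  by move=> /andP[_ ->] /andP[_ ->].
case/andP: abe => ae be.
have ab : a != b by case/and3P: uh => _; rewrite inE.
have [c cE] : exists c, e :\ a :\ b = [set c].
  apply/cards1P; have := H3 eH.
  by rewrite (cardsD1 a) ae (cardsD1 b) !inE eq_sym ab be !add1n => -[->].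
have /setD1P[cb /setD1P[ca ce]] : c \in e :\ a :\ b by rewrite cE set11.
have ue2 : uniq [:: a; b; c] by rewrite /= !inE negb_or ab eq_sym ca eq_sym cb.
have Ee2 : e =i [:: a; b; c].
  have bea : b \in e :\ a by rewrite !inE eq_sym ab.
  by move=> w; rewrite -(setD1K ae) -(setD1K bea) cE !inE.
have [f0 [f1 [f2 [uf Ef]]]] := card3P (H3 fH).
pose vs := [:: a; b; c] ++ [:: f0; f1; f2] ++ [:: u].
have uvs : uniq vs.
  apply: uniq_cat3 => //; first exact: disjoint_uniq Ee2 Ef def.
    by rewrite /= orbF -Ee2.
  rewrite /= orbF -Ef; apply/negP => uf'; move/disjP: dhf => /(_ u); exact.
have eL : e = lab a vs [:: 0; 1; 2] by apply/setP => w; rewrite inE Ee2.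
have fL : f = lab a vs [:: 3; 4; 5] by apply/setP => w; rewrite inE Ef.
have hL : h = lab a vs [:: 6; 0; 1] by apply/setP => w; rewrite inE Eh.
rewrite eL fL; apply: leq_trans (_ : count (fun c => lab a vs c \in H)
  (label_bridges 6 [:: 0; 1; 2] [:: 3; 4; 5]) <= _).
  apply: card_le_count => g gb; split; first by move: gb; rewrite inE => /andP[].
  by apply: bridge_lab gb; rewrite -?eL -?fL.
apply: (few_compatible_count uvs Hfree
  (S := [:: [:: 0; 1; 2]; [:: 3; 4; 5]; [:: 6; 0; 1]])).
- by [].
- by rewrite /= -eL -fL -hL eH fH hH.
- by vm_compute.
by vm_compute.
Qed.

(* A bridged pair of edges with many bridges is cut off from the rest of [H]. *)
Lemma bridge_le9 e f h : e \in H -> f \in H -> h \in H -> [disjoint e & f] ->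
  ~~ [disjoint h & e :|: f] -> ~~ (h \subset e :|: f) -> #|bridge e f| <= 9.
Proof.
have half e' f' : e' \in H -> f' \in H -> h \in H -> [disjoint e' & f'] ->
    ~~ [disjoint h & e'] -> ~~ (h \subset e' :|: f') -> #|bridge e' f'| <= 9.
  move=> eH fH hH def me nsub; have dhf : [disjoint h & f'].
    apply: contraNT nsub => mf; apply: (sub_union_meet Hfree) => //; exact: H3.
  have : 0 < #|h :&: e'| < 3.
    rewrite lt0n cards_eq0 setI_eq0 me /= -(H3 hH) ltn_neqAle subset_leq_card ?subsetIl // andbT.
    apply: contra nsub => /eqP E; apply: subset_trans (subsetUl _ _).
    by apply/setIidPl/eqP; rewrite eqEcard subsetIl E leqnn.
  case E: #|h :&: e'| => [|[|[|]]] // _.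
    exact: leq_trans (bridge_le3 eH fH hH def E dhf) _.
  exact: bridge_le9_cross2 eH fH hH def E dhf.
move=> eH fH hH def; rewrite -setI_eq0 setIUr setU_eq0 negb_and !setI_eq0.
case/orP => m nsub; first exact: half.
by rewrite bridgeC; apply: half => //; rewrite 1?disjoint_sym 1?setUC.
Qed.

(** Two bridged pairs are needed: a single one may come from a complete system on six points, with
    18 bridges. One bridge of each pair is fixed, and the search runs over all choices of these two.
    The bound amounts to four bridges per pair on average. *)
Lemma bridge_triangle e1 e2 e3 : e1 \in H -> e2 \in H -> e3 \in H ->
  [disjoint e1 & e2] -> [disjoint e1 & e3] -> [disjoint e2 & e3] ->
  bridge e1 e2 != set0 -> bridge e1 e3 != set0 ->
  #|bridge e1 e2| + #|bridge e1 e3| + #|bridge e2 e3| <= 12.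
Proof.
move=> e1H e2H e3H d12 d13 d23 /set0Pn[g gb] /set0Pn[g' gb'].
have [a0 [a1 [a2 [ua Ea]]]] := card3P (H3 e1H).
have [b0 [b1 [b2 [ub Eb]]]] := card3P (H3 e2H).
have [c0 [c1 [c2 [uc Ec]]]] := card3P (H3 e3H).
pose vs := [:: a0; a1; a2] ++ [:: b0; b1; b2] ++ [:: c0; c1; c2].
have uvs : uniq vs.
  by apply: uniq_cat3 => //; [exact: disjoint_uniq Ea Eb d12|
   exact: disjoint_uniq Ea Ec d13|exact: disjoint_uniq Eb Ec d23].
pose L1 := [:: 0; 1; 2]; pose L2 := [:: 3; 4; 5]; pose L3 := [:: 6; 7; 8].
have E1 : e1 = lab a0 vs L1 by apply/setP => w; rewrite inE Ea.
have E2 : e2 = lab a0 vs L2 by apply/setP => w; rewrite inE Eb.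
have E3 : e3 = lab a0 vs L3 by apply/setP => w; rewrite inE Ec.
have B12 h : h \in bridge e1 e2 -> exists2 c, c \in label_bridges 9 L1 L2 & h = lab a0 vs c.
  by rewrite E1 E2 => hb; apply: bridge_lab hb; rewrite -?E1 -?E2.
have B13 h : h \in bridge e1 e3 -> exists2 c, c \in label_bridges 9 L1 L3 & h = lab a0 vs c.
  by rewrite E1 E3 => hb; apply: bridge_lab hb; rewrite -?E1 -?E3.
have B23 h : h \in bridge e2 e3 -> exists2 c, c \in label_bridges 9 L2 L3 & h = lab a0 vs c.
  by rewrite E2 E3 => hb; apply: bridge_lab hb; rewrite -?E2 -?E3.
have [c cb gE] := B12 g gb; have [c' cb' gE'] := B13 g' gb'.
have gH : g \in H by move: gb; rewrite inE => /andP[].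
have gH' : g' \in H by move: gb'; rewrite inE => /andP[].
pose P c := lab a0 vs c \in H.
(* With labels below 9 these lists also contain triples meeting all three edges. Such a triple is
   the middle of a path between two of them, hence [few_compatible] discards it at once. *)
apply: leq_trans (_ : count P (label_bridges 9 L1 L2 ++ label_bridges 9 L1 L3
   ++ label_bridges 9 L2 L3) <= _).
  rewrite !count_cat addnA; do 2?apply: leq_add; apply: card_le_count => h hb.
  - by split; [move: hb; rewrite inE => /andP[]|exact: B12].
  - by split; [move: hb; rewrite inE => /andP[]|exact: B13].
  by split; [move: hb; rewrite inE => /andP[]|exact: B23].
have wb d1 d2 : all (wf vs) (label_bridges 9 d1 d2).
  apply/allP => d; rewrite mem_filter => /andP[_].
  by apply: (allP (@triples_below_wf _ vs 9 _)).
apply: (few_compatible_count uvs Hfree (S := [:: L1; L2; L3; c; c'])).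
- by rewrite /= (allP (wb _ _) _ cb) (allP (wb _ _) _ cb').
- by rewrite /= -E1 -E2 -E3 -gE -gE' e1H e2H e3H gH gH'.
- by rewrite !all_cat !wb.
have : all (fun c => all (fun c' => few_compatible [:: L1; L2; L3; c; c']
    (label_bridges 9 L1 L2 ++ label_bridges 9 L1 L3 ++ label_bridges 9 L2 L3) 12)
    (label_bridges 9 L1 L3)) (label_bridges 9 L1 L2) by vm_compute.
by move=> /allP/(_ _ cb)/allP/(_ _ cb').
Qed.

End Bridges.

(** * Intersecting triple systems *)

Section Intersecting.
Variable T : finType.
Implicit Types (x z s t w : T) (Q W h g e : {set T}) (F : {set {set T}}).

Definition triples Q := [set h : {set T} | h \subset Q & #|h| == 3].

Definition intersecting F := {in F &, forall g h, ~~ [disjoint g & h]}.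

Lemma card_triples Q : #|triples Q| = 'C(#|Q|, 3).
Proof. exact: cards_draws. Qed.

Lemma in_triples Q h : (h \in triples Q) = (h \subset Q) && (#|h| == 3).
Proof. by rewrite inE. Qed.

Lemma triplesP Q F h : F \subset triples Q -> h \in F ->
  #|h| = 3 /\ {subset h <= Q}.
Proof.
by move=> /subsetP sub /sub; rewrite inE => /andP[/subsetP ? /eqP].
Qed.

Lemma codegree_le W x s F : x != s ->
  (forall h, h \in F -> [/\ #|h| = 3, x \in h, s \in h &
     exists w, [&& w \in W, w \in h, w != x & w != s]]) -> #|F| <= #|W|.
Proof.
move=> xs P; apply: leq_trans (leq_imset_card (fun w => [set x; s; w]) W).
apply/subset_leq_card/subsetP => h /P[h3 xh sh [w /and4P[wW wh wx ws]]].
apply/imsetP; exists w => //; apply/eqP; rewrite eq_sym eqEcard.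
apply/andP; split; first by apply/subsetP => v; rewrite !inE -orbA => /or3P[] /eqP->.
by rewrite h3 setUC cardsU1 cards2 xs !inE negb_or wx ws.
Qed.

Lemma card_setU_le (A B C : {set {set T}}) : C \subset A :|: B -> #|C| <= #|A| + #|B|.
Proof.
move=> /subset_leq_card le; apply: leq_trans le _.
by rewrite cardsU leq_subr.
Qed.

Lemma third h x s : #|h| = 3 -> x != s -> x \in h -> s \in h ->
  exists w, [&& w \in h, w != x & w != s].
Proof.
move=> h3 xs xh sh; have /card_gt0P[w] : 0 < #|h :\ x :\ s|.
  have := h3; rewrite (cardsD1 x) xh (cardsD1 s) !inE eq_sym xs sh !add1n => -[->] //.
by rewrite !inE => /and3P[ws wx wh]; exists w; rewrite wh wx ws.
Qed.

Lemma cardsD2 Q x z : x \in Q -> z \in Q -> x != z -> #|Q :\ x :\ z| = #|Q| - 2.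
Proof.
move=> xQ zQ xz; rewrite (cardsD1 x Q) xQ (cardsD1 z (Q :\ x)) !inE eq_sym xz zQ.
by rewrite addnA addKn.
Qed.

Lemma cardsD3 Q x z s : x \in Q -> z \in Q -> s \in Q -> uniq [:: x; z; s] ->
  #|Q :\ x :\ z :\ s| = #|Q| - 3.
Proof.
move=> xQ zQ sQ /and3P[]; rewrite !inE negb_or => /andP[xz xs] zs _.
have := cardsD2 xQ zQ xz; rewrite (cardsD1 s (Q :\ x :\ z)) !inE.
by rewrite [s == z]eq_sym zs [s == x]eq_sym xs sQ /= add1n => E; rewrite (subnS _ 2) -E.
Qed.

Lemma star_pair_le Q F x z s : F \subset triples Q -> x \in Q -> z \in Q -> s \in Q ->
  uniq [:: x; z; s] -> (forall h, h \in F -> [&& x \in h, s \in h & z \notin h]) ->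
  #|F| <= #|Q| - 3.
Proof.
move=> FQ xQ zQ sQ u P; rewrite -(cardsD3 xQ zQ sQ u).
move: u => /and3P[]; rewrite !inE negb_or => /andP[xz xs] zs _.
apply: (codegree_le xs) => h hF; have [h3 hQ] := triplesP FQ hF.
have /and3P[xh sh zh] := P h hF; have [w /and3P[wh wx ws]] := third h3 xs xh sh.
split=> //; exists w; rewrite !inE wh wx ws hQ // !andbT.
by apply: contraNneq zh => <-.
Qed.

(** An edge through [x] missing [z] meets g = {z, s, t} in s or t; in either case its third vertex
    has |Q| - 3 possible values. *)
Lemma cross_le1 Q F x z g : F \subset triples Q -> intersecting F -> x \in Q -> x != z ->
  g \in F -> z \in g -> x \notin g ->
  #|[set h in F | (x \in h) && (z \notin h)]| <= 2 * (#|Q| - 3).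
Proof.
move=> FQ FI xQ xz gF zg xg; have [g3 gQ] := triplesP FQ gF.
have [s [t [u E]]] := card3_with g3 zg.
pose G s := [set h in F | [&& x \in h, s \in h & z \notin h]].
have nx v : v \in g -> v != x by move=> vg; apply: contraNneq xg => <-.
have le v : v \in g -> v != z -> #|G v| <= #|Q| - 3.
  move=> vg vz; apply: (@star_pair_le Q _ x z v) => //; try by rewrite gQ.
  - by apply: subset_trans FQ; apply/subsetP => h; rewrite inE => /andP[].
  - by rewrite /= !inE negb_or xz [x == _]eq_sym nx // [z == _]eq_sym vz.
  by move=> h; rewrite inE => /andP[].
have [sg tg] : s \in g /\ t \in g by rewrite !E !inE !eqxx !orbT.
move: u => /and3P[]; rewrite !inE negb_or => /andP[zs zt] st _.
apply: leq_trans (card_setU_le (A := G s) (B := G t) _) _; last first.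
  by rewrite mul2n -addnn leq_add // le // eq_sym.
apply/subsetP => h; rewrite !inE => /and3P[hF xh zh]; rewrite hF xh zh !andbT /=.
have /meetP[v vg vh] := FI _ _ gF hF.
move: vg; rewrite E !inE => /or3P[] /eqP vE; move: vh; rewrite vE => vh.
- by rewrite vh in zh.
- by rewrite vh.
by rewrite vh orbT.
Qed.

(** An edge through [x] missing [z] has to meet both [g1] and [g2] outside [z]; two such obligations
    leave half of the room that a single one leaves. *)
Lemma cross_le2 Q F x z g1 g2 : F \subset triples Q -> intersecting F -> 6 <= #|Q| ->
  x \in Q -> x != z -> g1 \in F -> z \in g1 -> x \notin g1 ->
  g2 \in F -> z \in g2 -> x \notin g2 -> g1 != g2 ->
  #|[set h in F | (x \in h) && (z \notin h)]| <= #|Q| - 2.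
Proof.
move=> FQ FI Q6 xQ xz g1F zg1 xg1 g2F zg2 xg2 g12; have [c1 g1Q] := triplesP FQ g1F.
have [c2 g2Q] := triplesP FQ g2F.
have [t' t'2 t'1] : exists2 t', t' \in g2 & t' \notin g1.
  by apply/subsetPn; apply: contraNN g12 => sub; rewrite eq_sym eqEcard sub c1 c2.
have zt' : z != t' by apply: contraNneq t'1 => <-.
have [s' /and3P[s'2 s'z s't']] := third c2 zt' zg2 t'2.
have g2E : g2 =i [:: z; s'; t'].
  move=> v; rewrite inE; apply/idP/idP => [vg|]; last first.
    by rewrite !inE => /or3P[] /eqP ->.
  apply: contraLR (leqnn #|g2|) => nv; rewrite -ltnNge {1}c2.
  apply: leq_trans (subset_leq_card (_ : [set v; z; s'; t'] \subset g2)).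
    move: nv; rewrite !inE !negb_or => /and3P[vz vs' vt'].
    rewrite -!setUA !cardsU1 cards1 !inE !negb_or vz vs' vt' eq_sym s'z zt' s't' //.
  by apply/subsetP => w; rewrite !inE -!orbA => /or4P[] /eqP ->.
have meet2 h : h \in F -> z \notin h -> (s' \in h) || (t' \in h).
  move=> hF zh; have /meetP[v] := FI _ _ g2F hF.
  rewrite g2E !inE => /or3P[] /eqP-> vh; rewrite ?vh ?orbT //.
  by rewrite vh in zh.
(* If [g1] and [g2] share [s'] besides [z], an edge counted here contains [s'], or it is {x, t, t'}:
   together at most (|Q| - 3) + 1. *)
have [s'1|s'1] := boolP (s' \in g1).
  have zs' : z != s' by rewrite eq_sym.
  have [t /and3P[tg1 tz ts']] := third c1 zs' zg1 s'1.
  have meet1 h : h \in F -> z \notin h -> (s' \in h) || (t \in h).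
    move=> hF zh; have /meetP[v vg vh] := FI _ _ g1F hF.
    have [E|E] := eqVneq v s'; first by rewrite -E vh.
    have [E'|E'] := eqVneq v t; first by rewrite -E' vh orbT.
    have vz : v != z by apply: contraNneq zh => <-.
    have : #|[set v; z; s'; t]| <= #|g1|.
      by apply: subset_leq_card; apply/subsetP => w; rewrite !inE -!orbA => /or4P[] /eqP ->.
    by rewrite c1 -!setUA !cardsU1 cards1 !inE !negb_or vz E E' zs' [z == t]eq_sym tz [s' == t]eq_sym ts'.
  pose G := [set h in F | [&& x \in h, s' \in h & z \notin h]].
  have leG : #|G| <= #|Q| - 3.
    apply: (@star_pair_le Q _ x z s') => //; try by rewrite ?g1Q.
    - by apply: subset_trans FQ; apply/subsetP => h; rewrite inE => /andP[].
    - rewrite /= !inE negb_or xz zs' andbT andbT.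
      by apply: contraNneq xg1 => ->.
    by move=> h; rewrite inE => /andP[].
  apply: leq_trans (card_setU_le (A := G) (B := [set [set x; t; t']]) _) _; last first.
    by rewrite cards1; clear -leG Q6; lia.
  apply/subsetP => h; rewrite !inE => /and3P[hF xh zh]; rewrite hF xh zh !andbT /=.
  have := meet1 h hF zh; have := meet2 h hF zh.
  have [//|s'h] /= := boolP (s' \in h) => t'h th.
  rewrite eq_sym eqEcard; apply/andP; split.
    by apply/subsetP => w; rewrite !inE -orbA => /or3P[] /eqP ->.
  have [-> _] := triplesP FQ hF.
  rewrite -setUA !cardsU1 cards1 !inE negb_or.
  have -> : x != t by apply: contraNneq xg1 => ->.
  have -> : x != t' by apply: contraNneq xg2 => ->.
  by have -> : t != t' by apply: contraNneq t'1 => <-.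
(* Otherwise [g1] and [g2] share only [z], and the edges are among the four sets {x, s or t, s' or
   t'}; four is at most |Q| - 2 because |Q| is at least 6. *)
have [s [t [u E]]] := card3_with c1 zg1.
have in2 a b : b != x -> [set h in F | [&& x \in h, a \in h & b \in h]] \subset
    [set [set x; a; b]] \/ a = b \/ x = a.
  move=> bx; have [->|ab] := eqVneq a b; first by right; left.
  have [->|xa] := eqVneq x a; first by right; right.
  left; apply/subsetP => h; rewrite !inE => /and4P[hF xh ah bh].
  rewrite eq_sym eqEcard; apply/andP; split.
    by apply/subsetP => w; rewrite !inE -orbA => /or3P[] /eqP ->.
  have [-> _] := triplesP FQ hF.
  by rewrite -setUA !cardsU1 cards1 !inE negb_or xa ab eq_sym bx.
pose D := [set [set x; p.1; p.2] | p : T * T in setX [set s; t] [set s'; t']].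
have leD : #|D| <= 4.
  by apply: leq_trans (leq_imset_card _ _) _; rewrite cardsX !cards2; do 2!case: eqP.
apply: leq_trans (_ : #|D| <= _); last by clear -leD Q6; lia.
apply/subset_leq_card/subsetP => h; rewrite !inE => /and3P[hF xh zh].
have [a ag ah] : exists2 a, a \in [set s; t] & a \in h.
  have /meetP[v vg vh] := FI _ _ g1F hF; exists v => //.
  move: vg; rewrite E !inE => /or3P[] /eqP vE; rewrite vE ?eqxx ?orbT //.
  by rewrite -vE vh in zh.
have [b bg bh] : exists2 b, b \in [set s'; t'] & b \in h.
  by have := meet2 h hF zh => /orP[] H; [exists s'|exists t']; rewrite // !inE eqxx ?orbT.
have ag1 : a \in g1 by rewrite E inE; move: ag; rewrite !inE => ->; rewrite orbT.
have bg1 : b \notin g1 by move: bg; rewrite !inE => /orP[] /eqP ->.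
have bg2 : b \in g2 by move: bg; rewrite !inE => /orP[] /eqP ->.
have bx : b != x by apply: contraNneq xg2 => <-.
case: (in2 a b bx) => [/subsetP/(_ h)|[ab|xa]].
- rewrite inE hF xh ah bh => /(_ isT)/set1P ->; apply/imsetP; exists (a, b) => //.
  by rewrite !inE; move: ag bg; rewrite !inE => -> ->.
- by rewrite -ab ag1 in bg1.
by rewrite -xa in ag1; rewrite ag1 in xg1.
Qed.

(** At most |Q| - 2 edges contain both points. If two or more edges contain exactly [x], and
    likewise exactly [z], then [cross_le2] gives |Q| - 2 for each sort. If one sort has at most one
    edge, [cross_le1] gives 2 (|Q| - 3) for the other, and the total is even smaller by one. *)
Lemma intersecting_cover2 Q F x z : F \subset triples Q -> intersecting F -> 6 <= #|Q| ->
  (forall h, h \in F -> (x \in h) || (z \in h)) ->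
  (forall v, exists2 h, h \in F & v \notin h) ->
  #|F| <= 3 * #|Q| - 6.
Proof.
move=> FQ FI Q6 cov nostar.
have [gx gxF zgx] := nostar z; have [gz gzF xgz] := nostar x.
have xgx : x \in gx by move: (cov _ gxF); rewrite (negPf zgx) orbF.
have zgz : z \in gz by move: (cov _ gzF); rewrite (negPf xgz).
have xz : x != z by apply: contraNneq zgx => <-.
have xQ : x \in Q by have [_] := triplesP FQ gxF; apply.
have zQ : z \in Q by have [_] := triplesP FQ gzF; apply.
pose Fxz := [set h in F | (x \in h) && (z \in h)].
pose Gx := [set h in F | (x \in h) && (z \notin h)].
pose Gz := [set h in F | (z \in h) && (x \notin h)].
have leF : #|F| <= #|Fxz| + (#|Gx| + #|Gz|).
  apply: leq_trans (_ : #|Fxz| + #|Gx :|: Gz| <= _); last first.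
    by rewrite leq_add2l card_setU_le.
  apply: card_setU_le; apply/subsetP => h hF; move: (cov _ hF); rewrite !inE hF.
  by case: (x \in h) (z \in h) => [] [].
have lexz : #|Fxz| <= #|Q| - 2.
  rewrite -(cardsD2 xQ zQ xz); apply: (codegree_le xz) => h.
  rewrite inE => /and3P[hF xh zh]; have [h3 hQ] := triplesP FQ hF.
  have [w /and3P[wh wx wz]] := third h3 xz xh zh.
  by split=> //; exists w; rewrite !inE wh wx wz hQ.
have zx : z != x by rewrite eq_sym.
have [Gx1|Gx2] := leqP #|Gx| 1.
  have leGz := cross_le1 FQ FI zQ zx gxF xgx zgx; rewrite -/Gz in leGz.
  by clear -leF lexz leGz Gx1 Q6; lia.
have [Gz1|Gz2] := leqP #|Gz| 1.
  have leGx := cross_le1 FQ FI xQ xz gzF zgz xgz; rewrite -/Gx in leGx.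
  by clear -leF lexz leGx Gz1 Q6; lia.
have leGz : #|Gz| <= #|Q| - 2.
  case/card_gt1P: Gx2 => g1 [g2 []]; rewrite !inE => /and3P[? ? ?] /and3P[? ? ?] n.
  exact: (cross_le2 (g1 := g1) (g2 := g2)).
have leGx : #|Gx| <= #|Q| - 2.
  case/card_gt1P: Gz2 => g1 [g2 []]; rewrite !inE => /and3P[? ? ?] /and3P[? ? ?] n.
  exact: (cross_le2 (g1 := g1) (g2 := g2)).
by clear -leF lexz leGx leGz Q6; lia.
Qed.

(** Two points lie in at most 3 common edges, since their third vertex is on an edge avoiding both.
    Fix an edge {a, b, c}. The edges through [a] meet an edge avoiding [a], which allows 3 * 3 of
    them. Those through [b] but not [a] meet an edge that contains [a] and avoids [b], [c], in one
    of its other two vertices, which allows 2 * 3; the same holds for [c]. The sum is 9 + 6 + 6. *)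
Lemma intersecting_nocover2 Q F : F \subset triples Q -> intersecting F ->
  (forall x z, exists2 h, h \in F & (x \notin h) && (z \notin h)) ->
  #|F| <= 21.
Proof.
move=> FQ FI nocov.
have [->|[e eF]] := set_0Vmem F; first by rewrite cards0.
have codeg x z : x != z -> #|[set h in F | (x \in h) && (z \in h)]| <= 3.
  move=> xz; have [g gF /andP[xg zg]] := nocov x z; have [<- _] := triplesP FQ gF.
  apply: (codegree_le xz) => h; rewrite inE => /and3P[hF xh zh].
  have [h3 _] := triplesP FQ hF; split=> //.
  have /meetP[w wg wh] := FI _ _ gF hF; exists w; rewrite wg wh /=.
  by apply/andP; split; [apply: contraNneq xg|apply: contraNneq zg] => <-.
have [a [b [c [u E]]]] := card3P (triplesP FQ eF).1.
have cov h : h \in F -> [|| a \in h, b \in h | c \in h].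
  move=> hF; have /meetP[v] := FI _ _ eF hF.
  by rewrite E !inE => /or3P[] /eqP -> ->; rewrite ?orbT.
have [g gF /andP[bg cg]] := nocov b c.
have ag : a \in g by move: (cov _ gF); rewrite (negPf bg) (negPf cg) !orbF.
have [s [t [ug Eg]]] := card3_with (triplesP FQ gF).1 ag.
have [g' gF' /andP[ag' _]] := nocov a a.
have [p [q [r [ug' Eg']]]] := card3P (triplesP FQ gF').1.
pose C x z := [set h in F | (x \in h) && (z \in h)].
pose N x := [set h in F | (a \notin h) && (x \in h)].
have leN x : x \notin g -> #|N x| <= 6.
  move=> xg; have nx v : v \in g -> x != v by move=> vg; apply: contraNneq xg => ->.
  apply: leq_trans (card_setU_le (A := C x s) (B := C x t) _) _; last first.
    by apply: (@leq_add _ _ 3 3); apply: codeg; apply: nx; rewrite Eg !inE eqxx ?orbT.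
  apply/subsetP => h; rewrite !inE => /and3P[hF ah xh]; rewrite hF xh /=.
  have /meetP[v] := FI _ _ gF hF.
  by rewrite Eg !inE => /or3P[] /eqP ->; rewrite ?(negPf ah) // => ->; rewrite ?orbT.
pose Na := [set h in F | a \in h].
have leNa : #|Na| <= 9.
  have na v : v \in g' -> a != v by move=> vg; apply: contraNneq ag' => ->.
  apply: leq_trans (_ : #|C a p| + #|C a q :|: C a r| <= _).
    apply: card_setU_le; apply/subsetP => h; rewrite !inE => /andP[hF ah]; rewrite hF ah /=.
    have /meetP[v] := FI _ _ gF' hF.
    by rewrite Eg' !inE => /or3P[] /eqP -> ->; rewrite ?orbT.
  apply: leq_trans (leq_add (leqnn _) (card_setU_le (subxx _))) _.
  by apply: (@leq_add _ _ 3 6); [|apply: (@leq_add _ _ 3 3)];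
    apply: codeg; apply: na; rewrite Eg' !inE eqxx ?orbT.
apply: leq_trans (_ : #|Na| + #|N b :|: N c| <= _).
  apply: card_setU_le; apply/subsetP => h hF; move: (cov _ hF); rewrite !inE hF /=.
  by case: (a \in h).
apply: leq_trans (leq_add (leqnn _) (card_setU_le (subxx _))) _.
by apply: (@leq_add _ _ 9 12) => //; apply: (@leq_add _ _ 6 6); apply: leN.
Qed.

(** The cases are the covering number: one point, two points, or more. *)
Lemma intersecting_star_or Q F : F \subset triples Q -> intersecting F -> 6 <= #|Q| ->
  (exists x, forall h, h \in F -> x \in h) \/ #|F| <= maxn (3 * #|Q| - 6) 21.
Proof.
move=> FQ FI Q6.
have [/existsP[x /forall_inP P]|ns] := boolP [exists x, [forall h in F, x \in h]].
  by left; exists x.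
right; have nostar v : exists2 h, h \in F & v \notin h.
  move: ns; rewrite negb_exists => /forallP/(_ v).
  by rewrite negb_forall_in => /exists_inP.
have [/existsP[x /existsP[z /forall_inP P]]|nc] :=
  boolP [exists x, exists z, [forall h in F, (x \in h) || (z \in h)]].
  by rewrite leq_max (intersecting_cover2 FQ FI Q6 P).
rewrite leq_max (intersecting_nocover2 FQ FI) ?orbT // => x z.
move: nc; rewrite negb_exists => /forallP/(_ x); rewrite negb_exists => /forallP/(_ z).
by rewrite negb_forall_in => /exists_inP[h hF]; rewrite negb_or; exists h.
Qed.

Lemma card_link_le Q F x :
  (forall h, h \in F -> [/\ #|h| = 3, x \in h & h :\ x \subset Q]) -> #|F| <= 'C(#|Q|, 2).
Proof.
move=> P; rewrite -cards_draws -(@card_in_imset _ _ (fun h => h :\ x) F).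
  apply/subset_leq_card/subsetP => _ /imsetP[h hF ->]; rewrite inE.
  have [h3 xh ->] := P h hF.
  by have := h3; rewrite (cardsD1 x) xh add1n => -[->].
move=> g h gF hF /= E; have [[_ xg _] [_ xh _]] := (P g gF, P h hF).
by rewrite -(setD1K xg) E setD1K.
Qed.

Lemma card_star_le Q F x : F \subset triples Q -> x \in Q ->
  (forall h, h \in F -> x \in h) -> #|F| <= 'C(#|Q|.-1, 2).
Proof.
move=> FQ xQ P; have -> : #|Q|.-1 = #|Q :\ x| by rewrite (cardsD1 x Q) xQ.
apply: (@card_link_le _ _ x) => h hF; have [h3 hQ] := triplesP FQ hF.
by split; [exact: h3|exact: P|rewrite setSD //; apply/subsetP].
Qed.

(** Of two complementary triples of a 6-set at most one belongs to an intersecting system. *)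
Lemma intersecting6 Q F : F \subset triples Q -> intersecting F -> #|Q| = 6 -> #|F| <= 10.
Proof.
move=> FQ FI Q6; have : #|F :|: [set Q :\: h | h in F]| <= 20.
  have -> : 20 = #|triples Q| by rewrite card_triples Q6.
  apply/subset_leq_card/subsetP => h; rewrite inE => /orP[/(subsetP FQ) //|/imsetP[g gF ->]].
  have [g3 gQ] := triplesP FQ gF; rewrite inE subsetDl cardsD (setIidPr _) ?Q6 ?g3 //.
  exact/subsetP.
rewrite cardsU disjoint_setI0; last first.
  apply/disjP => h hF /imsetP[g gF E]; have /meetP[v vh vg] := FI _ _ hF gF.
  by move: vh; rewrite E inE vg.
rewrite cards0 subn0 card_in_imset; first by rewrite addnn (leq_double _ 10).
move=> g h gF hF /= E; have [_ gQ] := triplesP FQ gF; have [_ hQ] := triplesP FQ hF.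
have sub k : k \in F -> k \subset Q by move=> kF; apply/subsetP; have [] := triplesP FQ kF.
have K (k : {set T}) : k \subset Q -> Q :\: (Q :\: k) = k.
  by move=> kQ; rewrite setDDr setDv set0U; apply/setIidPr.
by rewrite -(K g) ?sub // E K ?sub.
Qed.

(** Averaging over the deletion of one of the seven points: each triple survives four deletions, so
    4 |F| is at most 7 * 10. *)
Lemma intersecting7 Q F : F \subset triples Q -> intersecting F -> #|Q| = 7 -> #|F| <= 17.
Proof.
move=> FQ FI Q7; pose A v := [set h in F | v \notin h].
have leA v : v \in Q -> #|A v| <= 10.
  move=> vQ; apply: (@intersecting6 (Q :\ v)).
  - apply/subsetP => h; rewrite inE => /andP[hF vh]; have [h3 hQ] := triplesP FQ hF.
    rewrite inE h3 eqxx andbT; apply/subsetP => w wh; rewrite !inE hQ // andbT.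
    by apply: contraNneq vh => <-.
  - by move=> g h; rewrite !inE => /andP[gF _] /andP[hF _]; apply: FI.
  by have := Q7; rewrite (cardsD1 v) vQ add1n => -[].
have : \sum_(v in Q) #|A v| <= \sum_(v in Q) 10 by apply: leq_sum.
rewrite sum_nat_const Q7.
have -> : \sum_(v in Q) #|A v| = \sum_(h in F) #|Q :\: h|.
  under eq_bigr do rewrite -sum1_card.
  under [RHS]eq_bigr do rewrite -sum1_card.
  rewrite (exchange_big_dep (mem F)) /=; last by move=> v h _; rewrite inE => /andP[].
  by apply: eq_bigr => h hF; apply: eq_bigl => v; rewrite !inE hF andbC.
rewrite (eq_bigr (fun=> 4)).
  by rewrite sum_nat_const; clear; move: #|F| => k; lia.
move=> h hF; have [h3 hQ] := triplesP FQ hF.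
by rewrite cardsD (setIidPr _) ?Q7 ?h3 //; apply/subsetP.
Qed.

(* Bounds intersecting triple systems on [m + 3] vertices. *)
Definition phi m :=
  if m < 3 then 'C(m + 3, 3) else
  if m == 3 then 10 else if m == 4 then 17 else
  maxn 'C(m + 2, 2) (maxn (3 * (m + 3) - 6) 21).

Lemma intersecting_le Q F m : F \subset triples Q -> intersecting F -> #|Q| = m + 3 ->
  #|F| <= phi m.
Proof.
move=> FQ FI Qm; rewrite /phi; case: ltnP => m3.
  by rewrite -Qm -card_triples subset_leq_card.
case: eqP => [E|_]; first by apply: intersecting6 FQ FI _; rewrite Qm E.
case: eqP => [E|_]; first by apply: intersecting7 FQ FI _; rewrite Qm E.
have [|[x P]|] := intersecting_star_or FQ FI; first by rewrite Qm; clear -m3; lia.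
  have [->|[h hF]] := set_0Vmem F; first by rewrite cards0.
  have xQ : x \in Q by have [_] := triplesP FQ hF; apply; apply: P.
  apply: leq_trans (card_star_le FQ xQ P) _; rewrite Qm leq_max.
  by rewrite addnS /= leqnn.
by rewrite Qm => le; rewrite leq_max le orbT.
Qed.
End Intersecting.

(** * Edges around a maximum matching *)

(* Bounds the edges meeting one matching edge only, when [u] outside vertices are
   reached from that edge alone and [x] from several matching edges. *)
Definition psi x u :=
  maxn (phi u + (3 * x)./2) (if 0 < x then (maxn 3 (u + x)).+1 else 0).

Section Matching.
Variables (T : finType) (X : {set T}) (H : {set {set T}}).
Hypothesis Hfree : pfree H.
Hypothesis HX : H \subset triples X.
Implicit Types (v w : T) (f g h z : {set T}).

Lemma edge_card3 : {in H, forall h : {set T}, #|h| = 3}.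
Proof. by move=> h /(triplesP HX) []. Qed.

Lemma edge_sub h v : h \in H -> v \in h -> v \in X.
Proof. by move=> /(triplesP HX) [_]; apply. Qed.

Variables (k : nat) (e : 'I_k -> {set T}).
Hypothesis eH : forall i, e i \in H.
Hypothesis e_disj : forall i j, i != j -> [disjoint e i & e j].

Definition own i :=
  [set h in H | ~~ [disjoint h & e i] &
     [forall j, (j != i) ==> [disjoint h & e j]]].

Hypothesis e_meet : forall h, h \in H -> exists i, ~~ [disjoint h & e i].
Hypothesis own_meet : forall i, intersecting (own i).

Definition outside := X :\: \bigcup_i e i.

Definition attached i := [set v in outside | [exists h in own i, v \in h]].

Definition shared :=
  [set v in outside | [exists i, exists j, [&& i != j, v \in attached i & v \in attached j]]].

Definition private i := attached i :\: shared.

Lemma ownP i h : reflect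
  [/\ h \in H, ~~ [disjoint h & e i] & forall j, j != i -> [disjoint h & e j]]
  (h \in own i).
Proof.
rewrite inE; apply: (iffP and3P) => -[hH m d]; split=> //.
  by move=> j ji; move/forallP/(_ j): d; rewrite ji.
by apply/forallP => j; apply/implyP; apply: d.
Qed.

Lemma own_H i h : h \in own i -> h \in H.
Proof. by case/ownP. Qed.

Lemma outsideN i v : v \in outside -> v \notin e i.
Proof.
by rewrite inE => /andP[vn _]; apply: contra vn => ve; apply/bigcupP; exists i.
Qed.

Lemma own_split i h v : h \in own i -> v \in h -> v \notin e i -> v \in outside.
Proof.
case/ownP => hH _ d vh vi; rewrite inE (edge_sub hH vh) andbT.
apply/bigcupP => -[j _ vj]; have [ji|ji] := eqVneq j i; first by rewrite -ji vj in vi.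
by move/disjP: (d j ji) => /(_ v vh vj).
Qed.

Lemma own_cap i h : h \in own i -> #|h :&: e i| + #|h :&: outside| = 3.
Proof.
move=> ho; rewrite -(edge_card3 (own_H ho)) -cardsUI -setIUr.
have -> : h :&: e i :&: (h :&: outside) = set0.
  apply/eqP; rewrite -subset0; apply/subsetP => v; rewrite !inE => /andP[/andP[_ vi] /andP[_ vo]].
  by have := outsideN i; move=> /(_ v); rewrite inE vi => /(_ vo).
rewrite cards0 addn0; congr #|pred_of_set _|; apply/setIidPl/subsetP => v vh.
by rewrite in_setU; have [//|vi] := boolP (v \in e i); rewrite (own_split ho vh vi).
Qed.

Lemma own_cap_gt0 i h : h \in own i -> 0 < #|h :&: e i|.
Proof. by case/ownP => _ m _; rewrite lt0n cards_eq0 setI_eq0. Qed.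

(** [sub_union_meet] is applied to [h] and the disjoint edges [e i], [z]: as [h] meets both, its
    part outside the matching lies in [z]. The roles of [h] and [z] can be exchanged. *)
Lemma own_trace i j h z v : i != j -> h \in own i -> z \in own j ->
  v \in h -> v \in z -> h :&: outside = z :&: outside.
Proof.
have half i' j' h' z' : i' != j' -> h' \in own i' -> z' \in own j' ->
    v \in h' -> v \in z' -> h' :&: outside \subset z' :&: outside.
  move=> ij /ownP[hH m _] /ownP[zH _ d] vh vz.
  have sub : h' \subset e i' :|: z'.
    apply: (sub_union_meet Hfree) => //; first exact: edge_card3.
      by rewrite disjoint_sym d.
    by apply/meetP; exists v.
  apply/subsetP => w; rewrite !in_setI => /andP[wh wo]; rewrite wo andbT.
  by move/subsetP/(_ _ wh): sub; rewrite in_setU (negPf (outsideN _ wo)).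
move=> ij ho zo vh vz; apply/eqP; rewrite eqEsubset (half i j) //.
by rewrite (half j i) // eq_sym.
Qed.

Lemma attachedP i v :
  reflect (v \in outside /\ exists2 h, h \in own i & v \in h) (v \in attached i).
Proof.
rewrite [v \in attached i]inE; apply: (iffP andP) => -[vo ex]; split=> //.
  exact/exists_inP.
exact/exists_inP.
Qed.

Lemma shared_partner i v : v \in shared ->
  exists j z, [/\ i != j, z \in own j & v \in z].
Proof.
rewrite inE => /andP[_ /existsP[j /existsP[l /and3P[jl]]]].
move=> /attachedP[_ [z zo vz]] /attachedP[_ [z' zo' vz']].
have [E|ij] := eqVneq i j; first by exists l, z'; rewrite E.
by exists j, z.
Qed.

(** An edge at another matching edge has the same trace as [h], so all outside vertices of [h] are
    reached from both sides and are shared. *)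
Lemma shared_trace i h v : h \in own i -> v \in h -> v \in shared ->
  h :&: shared = h :&: outside.
Proof.
move=> ho vh vs; have [j [z [ij zo vz]]] := shared_partner i vs.
have E := own_trace ij ho zo vh vz.
apply/setP => w; rewrite !in_setI; have [wh|//] := boolP (w \in h).
apply/idP/idP => /= [|wo]; first by rewrite inE => /andP[].
have wz : w \in z.
  by have : w \in z :&: outside; [rewrite -E inE wh|rewrite inE => /andP[]].
rewrite inE wo; apply/existsP; exists i; apply/existsP; exists j; rewrite ij /=.
by apply/andP; split; apply/attachedP; split=> //; [exists h|exists z].
Qed.


Lemma shared_outside : shared \subset outside.
Proof. by apply/subsetP => v; rewrite inE => /andP[]. Qed.

Lemma sum_private : \sum_i #|private i| + #|shared| <= #|outside|.
Proof.
have -> : #|outside| = #|outside :\: shared| + #|shared|.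
  by rewrite -(cardsID shared outside) (setIidPr shared_outside) addnC.
rewrite leq_add2r -(sum1_card (mem (outside :\: shared))).
under eq_bigr do rewrite -sum1_card.
rewrite (exchange_big_dep (mem (outside :\: shared))) /=; last first.
  by move=> i v _ /setDP[/attachedP[vo _] vs]; rewrite in_setD vs vo.
apply: leq_sum => v; rewrite in_setD => /andP[vs vo].
rewrite sum1_card; apply/card_le1P => i /setDP[vi _].
move=> j; rewrite [RHS]inE; apply/idP/eqP => [/setDP[vj _]|->]; last by apply/setDP.
apply: contraNeq vs => ij; rewrite inE vo; apply/existsP; exists i; apply/existsP.
by exists j; rewrite eq_sym ij vi.
Qed.

(** These edges form an intersecting system on [e i] together with the private vertices, three more
    than the argument of [phi]. *)
Lemma own_private_le i : #|[set h in own i | [disjoint h & shared]]| <= phi #|private i|.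
Proof.
apply: (@intersecting_le _ (e i :|: private i)).
- apply/subsetP => h; rewrite inE => /andP[ho dh]; rewrite in_triples.
  rewrite (edge_card3 (own_H ho)) eqxx andbT; apply/subsetP => v vh.
  rewrite in_setU; have [//|vi] := boolP (v \in e i); rewrite in_setD.
  rewrite (disjointFr dh vh) /=; apply/attachedP; split; last by exists h.
  exact: own_split ho vh vi.
- by move=> g h /setIdP[go _] /setIdP[ho _]; apply: (own_meet go ho).
rewrite cardsU (edge_card3 (eH i)) disjoint_setI0 ?cards0 ?subn0 1?addnC //.
apply/disjP => v vi; rewrite in_setD => /andP[_ /attachedP[vo _]].
by rewrite (negPf (outsideN i vo)) in vi.
Qed.

(** Such an edge is determined by its part in [e i]: the complement of one vertex when [S] is a
    singleton, and a single vertex when [S] is larger. Both leave three choices. *)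
Lemma own_through_le i v (S : {set T}) :
  (forall h, h \in own i -> v \in h -> h :&: outside = S) -> 0 < #|S| ->
  #|[set h in own i | v \in h]| <= 3.
Proof.
move=> P S0; rewrite -(edge_card3 (eH i)).
have [S1|S2] := leqP #|S| 1.
  apply: leq_trans (leq_imset_card (fun b => (e i :\ b) :|: S) _).
  apply/subset_leq_card/subsetP => h; rewrite inE => /andP[ho vh].
  have := own_cap ho; rewrite (P h ho vh) => c.
  have e2 : #|h :&: e i| = 2 by move: S0 S1 c; clear; lia.
  have /eqP/cards1P[b bE] : #|e i :\: h| = 1.
    by rewrite cardsD setIC e2 (edge_card3 (eH i)).
  have /setDP[bi bh] : b \in e i :\: h by rewrite bE set11.
  apply/imsetP; exists b => //; apply/setP => w; rewrite -(P h ho vh) !inE.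
  have [wi|wi] /= := boolP (w \in e i); last first.
    rewrite andbF /=; have [wh|//] := boolP (w \in h).
    by have := own_split ho wh wi; rewrite inE => ->.
  rewrite andbT; have -> : (w == b) = (w \notin h).
    by have /setP/(_ w) := bE; rewrite !inE wi andbT => ->.
  by rewrite negbK; case: (w \in h).
apply: leq_trans (leq_imset_card (fun a => a |: S) _).
apply/subset_leq_card/subsetP => h; rewrite inE => /andP[ho vh].
have := own_cap ho; rewrite (P h ho vh) => c.
have /eqP/cards1P[a aE] : #|h :&: e i| = 1.
  by have := own_cap_gt0 ho; move: S2 c; clear; lia.
have /setIP[ah ai] : a \in h :&: e i by rewrite aE set11.
apply/imsetP; exists a => //; apply/setP => w; rewrite -(P h ho vh) in_setU1 in_setI.
have [wi|wi] := boolP (w \in e i).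
  have -> : (w \in outside) = false.
    by apply: contraTF wi; apply: outsideN.
  have /setP/(_ w) := aE; rewrite !inE wi andbT => <-.
  by rewrite andbF orbF.
have -> : (w == a) = false by apply: contraNF wi => /eqP ->.
by rewrite /=; have [wh|//] := boolP (w \in h); rewrite (own_split ho wh wi).
Qed.

(** Double counting: each of these edges contains two shared vertices, and each shared vertex lies
    in at most three of them by [own_through_le]. *)
Lemma own_shared_le i :
  (forall h, h \in own i -> ~~ [disjoint h & shared] -> #|h :&: outside| = 2) ->
  #|[set h in own i | ~~ [disjoint h & shared]]| <= (3 * #|shared|)./2.
Proof.
move=> two; set N := [set h in own i | _].
suff : #|N| * 2 <= #|shared| * 3.
  by move: #|N| #|shared| => a b; clear; lia.
have -> : #|N| * 2 = \sum_(h in N) #|h :&: shared|.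
  rewrite -sum_nat_const; apply: eq_bigr => h; rewrite inE => /andP[ho m].
  case/meetP: (m) => v vh vs.
  by rewrite (shared_trace ho vh vs) two.
rewrite -sum_nat_const; under eq_bigr do rewrite -sum1_card.
rewrite (exchange_big_dep (mem shared)) /=; last first.
  by move=> h v _; rewrite inE => /andP[].
apply: leq_sum => v vs; rewrite sum1_card.
have [j [z [ij zo vz]]] := shared_partner i vs.
apply: leq_trans (@own_through_le i v (z :&: outside) _ _).
- apply/subset_leq_card/subsetP => h.
  by move=> /andP[/setIdP[ho _] /setIP[vh _]]; apply/setIdP.
- by move=> h ho vh; apply: own_trace ij ho zo vh vz.
rewrite card_gt0; apply/set0Pn; exists v; rewrite inE vz.
by apply: (subsetP shared_outside).
Qed.

(* If [h0] leaves [e i] only through [u], which another matching edge also reaches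
   through [z0], then an edge [z] at [e i] avoiding [u] contains the rest of [h0]:
   otherwise [z0], [h0], [z] is a path. *)
Lemma own_single_le i h0 u : h0 \in own i -> h0 :&: outside = [set u] -> u \in shared ->
  #|own i| <= (maxn 3 #|attached i|).+1.
Proof.
move=> h0o h0u us; have [j [z0 [ij z0o uz0]]] := shared_partner i us.
have /setIP[uh0 uo] : u \in h0 :&: outside by rewrite h0u set11.
have z0u : z0 :&: outside = [set u] by rewrite -h0u (own_trace ij h0o z0o uh0 uz0).
have trace z : z \in own i -> u \in z -> z :&: outside = [set u].
  by move=> zo uz; rewrite -z0u; apply: own_trace ij zo z0o uz uz0.
have rest h z : h \in own i -> u \in h -> z \in own i -> u \notin z -> h :&: e i \subset z.
  move=> ho uh zo uz; have hu := trace h ho uh.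
  have cap1 : #|z0 :&: h| = 1.
    apply/eqP/cards1P; exists u; rewrite -hu; apply/setP => w; rewrite !in_setI.
    have [wh|] := boolP (w \in h); last by rewrite andbF.
    rewrite andbT /=; apply/idP/idP => [wz|wo].
      apply: (own_split ho wh); case/ownP: z0o => _ _ /(_ i ij) /disjP d.
      by apply/negP; apply: d.
    have : w \in [set u] by rewrite -hu inE wh.
    by move/set1P ->.
  have dz : [disjoint z0 & z].
    apply/disjP => w wz0 wz; have /setP/(_ u) := own_trace ij zo z0o wz wz0.
    by rewrite !in_setI (negPf uz) uz0 uo.
  have capi : #|h :&: z| <> 1.
    move=> c1; move/pfreeP: Hfree => /(_ z0 h z (own_H z0o) (own_H ho) (own_H zo)).
    by rewrite /is_path cap1 c1 dz.
  have sub : h :&: z \subset h :&: e i.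
    apply/subsetP => w /setIP[wh wz]; rewrite inE wh; apply: contraNT uz => wi.
    have : w \in [set u] by rewrite -hu inE wh (own_split ho wh wi).
    by move/set1P <-.
  have le2 : #|h :&: e i| <= #|h :&: z|.
    have := own_cap ho; rewrite hu cards1 => c.
    have : 0 < #|h :&: z| by rewrite lt0n cards_eq0 setI_eq0 (own_meet ho zo).
    by move: c capi; clear; lia.
  have /eqP <- : h :&: z == h :&: e i by rewrite eqEcard sub.
  exact: subsetIr.
(* If a second edge [h1] at [e i] contains [u], an edge avoiding [u] contains the two different
   pairs that [h0] and [h1] have in [e i], so it is [e i] itself. Otherwise [h0] is the only edge
   through [u]. *)
have [/existsP[h1 /and3P[h1o uh1 h10]]|nex] :=
  boolP [exists h1, [&& h1 \in own i, u \in h1 & h1 != h0]].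
  have only_e z : z \in own i -> u \notin z -> z = e i.
    move=> zo uz; apply/eqP; rewrite eq_sym eqEcard.
    rewrite (edge_card3 (own_H zo)) (edge_card3 (eH i)) leqnn andbT.
    have D2 h : h \in own i -> u \in h -> #|h :&: e i| = 2.
      by move=> ho uh; have := own_cap ho; rewrite (trace h ho uh) cards1 addn1 => -[].
    have [s01 s02] := (rest h0 z h0o uh0 zo uz, rest h1 z h1o uh1 zo uz).
    have lt2 : #|h0 :&: e i| < #|(h0 :&: e i) :|: (h1 :&: e i)|.
      apply: proper_card; rewrite properE subsetUl; apply: contra h10 => sub.
      rewrite eqEcard (edge_card3 (own_H h0o)) (edge_card3 (own_H h1o)) leqnn andbT.
      apply/subsetP => w wh; have [wi|wi] := boolP (w \in e i).
        have : w \in h0 :&: e i.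
          by apply: (subsetP sub); rewrite !in_setU !in_setI wh wi orbT.
        by move=> /setIP[].
      have : w \in [set u] by rewrite -(trace h1 h1o uh1) inE wh (own_split h1o wh wi).
      by move/set1P ->.
    have /eqP <- : (h0 :&: e i) :|: (h1 :&: e i) == e i.
      by rewrite eqEcard subUset !subsetIr (edge_card3 (eH i)) -(D2 h0).
    by rewrite subUset s01 s02.
  apply: leq_trans (_ : #|[set e i]| + #|[set h in own i | u \in h]| <= _).
    apply: card_setU_le; apply/subsetP => z zo; rewrite in_setU in_set1.
    have [uz|uz] := boolP (u \in z); first by apply/orP; right; apply/setIdP.
    by rewrite (only_e z zo uz) eqxx.
  rewrite cards1 add1n ltnS leq_max; apply/orP; left.
  by apply: own_through_le trace _; rewrite cards1.
(* Every edge at [e i] now consists of the pair [h0 :&: e i] and one more vertex, either the last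
   vertex of [e i] or an attached one. *)
apply: leq_trans (_ : #|[set w |: (h0 :&: e i) | w in (e i :\: h0) :|: attached i]| <= _).
  apply/subset_leq_card/subsetP => z zo.
  have sub : h0 :&: e i \subset z.
    have [uz|uz] := boolP (u \in z); last exact: rest h0o uh0 zo uz.
    suff -> : z = h0 by apply: subsetIl.
    apply/eqP; apply: contraNT nex => zh0; apply/existsP; exists z.
    by rewrite zo uz.
  have D2 : #|h0 :&: e i| = 2 by have := own_cap h0o; rewrite h0u cards1 addn1 => -[].
  have /eqP/cards1P[w wE] : #|z :\: (h0 :&: e i)| = 1.
    by rewrite cardsD (setIidPr sub) (edge_card3 (own_H zo)) D2.
  have /setDP[wz wD] : w \in z :\: (h0 :&: e i) by rewrite wE set11.
  apply/imsetP; exists w; last by rewrite -wE setUC -{1}(setIidPr sub) setID.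
  rewrite in_setU; have [wi|wi] := boolP (w \in e i).
    apply/orP; left; apply/setDP; split=> //.
    by apply: contra wD => wh; rewrite inE wh wi.
  apply/orP; right; apply/attachedP; split; last by exists z.
  exact: own_split zo wz wi.
apply: leq_trans (leq_imset_card _ _) _.
rewrite cardsU; apply: leq_trans (leq_subr _ _) _.
have -> : #|e i :\: h0| = 1.
  rewrite cardsD setIC (edge_card3 (eH i)).
  by have := own_cap h0o; rewrite h0u cards1 addn1 => -[->].
by rewrite add1n ltnS leq_max leqnn orbT.
Qed.

Lemma attached_le i : #|attached i| <= #|private i| + #|shared|.
Proof.
rewrite -(cardsID shared (attached i)) addnC leq_add2l.
exact/subset_leq_card/subsetIr.
Qed.

Lemma single_in_shared i h : h \in own i -> #|h :&: outside| = 1 ->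
  ~~ [disjoint h & shared] -> 0 < #|shared| /\ #|own i| <= (maxn 3 #|attached i|).+1.
Proof.
move=> ho /eqP/cards1P[u hu] /meetP[v vh vs].
have vE : v = u.
  by apply/set1P; rewrite -hu inE vh (subsetP shared_outside).
split; first by rewrite card_gt0; apply/set0Pn; exists v.
by apply: own_single_le ho hu _; rewrite -vE.
Qed.

(** If an edge leaves [e i] through just one vertex and that vertex is shared, the second term of
    [psi] applies by [own_single_le]. Otherwise every edge meeting [shared] has two vertices
    outside, and the first term adds the edges missing [shared] to those meeting it. *)
Lemma own_le i : #|own i| <= psi #|shared| #|private i|.
Proof.
rewrite /psi leq_max.
have [/exists_inP[h ho /andP[/eqP h1 m]]|nex] := boolP
  [exists h in own i, (#|h :&: outside| == 1) && ~~ [disjoint h & shared]].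
  have [-> le] := single_in_shared ho h1 m.
  apply/orP; right; apply: leq_trans le _; rewrite ltnS geq_max leq_maxl /=.
  by rewrite leq_max attached_le orbT.
apply/orP; left; apply: leq_trans (leq_add (own_private_le i) (@own_shared_le i _)).
  apply: card_setU_le; apply/subsetP => h ho; rewrite in_setU.
  have [d|d] := boolP [disjoint h & shared].
    by apply/orP; left; apply/setIdP.
  by apply/orP; right; apply/setIdP.
move=> h ho m; have : #|h :&: outside| != 1.
  apply: contraNneq nex => h1; apply/exists_inP; exists h; rewrite ?h1 //.
have := own_cap ho; have := own_cap_gt0 ho.
have : 0 < #|h :&: outside|.
  case/meetP: m => v vh vs; rewrite card_gt0; apply/set0Pn; exists v.
  by rewrite inE vh (subsetP shared_outside).
by move: #|h :&: outside| #|h :&: e i| => a b; clear; lia.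
Qed.

Lemma own_le_degree i d : (forall x, #|[set h in H | x \in h]| <= d) ->
  6 <= #|outside| + 3 -> 21 <= d -> 3 * (#|outside| + 3) - 6 <= d -> #|own i| <= d.
Proof.
move=> deg big d21 dR.
have ownQ : own i \subset triples (e i :|: outside).
  apply/subsetP => h ho; rewrite in_triples (edge_card3 (own_H ho)) eqxx andbT.
  apply/subsetP => v vh; rewrite in_setU; have [//|vi] := boolP (v \in e i).
  exact: own_split ho vh vi.
have Q : #|e i :|: outside| = #|outside| + 3.
  rewrite cardsU (edge_card3 (eH i)) disjoint_setI0 ?cards0 ?subn0 1?addnC //.
  by apply/disjP => v vi vo; rewrite (negPf (outsideN i vo)) in vi.
have [|[x P]|le] := intersecting_star_or ownQ (own_meet (i := i)).
- by rewrite Q.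
- apply: leq_trans (deg x); apply/subset_leq_card/subsetP => h ho.
  by apply/setIdP; split; [exact: own_H ho|exact: P].
by apply: leq_trans le _; rewrite Q geq_max d21 dR.
Qed.

(** Apart from [e i], each edge has exactly one outside vertex, and three edges at most use the same
    one. *)
Lemma own_thin_le i : (forall h, h \in own i -> #|h :&: outside| <= 1) ->
  #|own i| <= (3 * #|attached i|).+1.
Proof.
move=> thin; apply: leq_trans (_ : #|[set e i]| + #|own i :\ e i| <= _).
  apply: card_setU_le; apply/subsetP => h ho.
  by rewrite in_setU in_set1 in_setD1 ho andbT orbN.
rewrite cards1 add1n ltnS; have cap1 h : h \in own i -> h != e i -> #|h :&: outside| = 1.
  move=> ho he; have := thin h ho; have := own_cap ho.
  have : #|h :&: e i| <> 3.
    move=> c3; case/eqP: he; apply/eqP.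
    have sub : h :&: e i \subset h by apply: subsetIl.
    have /eqP E : h :&: e i == h by rewrite eqEcard sub c3 (edge_card3 (own_H ho)).
    by rewrite eqEcard -{1}E subsetIr (edge_card3 (own_H ho)) (edge_card3 (eH i)).
  by move: #|h :&: outside| #|h :&: e i| => a b; clear; lia.
apply: leq_trans (_ : \sum_(v in attached i) #|[set h in own i | v \in h & h != e i]| <= _).
  under eq_bigr do rewrite -sum1_card.
  rewrite (exchange_big_dep (mem (own i :\ e i))) /=; last first.
    by move=> v h _ /setIdP[ho /andP[_ he]]; apply/setD1P.
  rewrite -sum1_card; apply: leq_sum => h /setD1P[he ho].
  have /eqP/cards1P[v hv] := cap1 h ho he.
  have /setIP[vh vo] : v \in h :&: outside by rewrite hv set11.
  rewrite (bigD1 v) //=; apply/andP; split; last by apply/setIdP; rewrite vh he.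
  by apply/attachedP; split=> //; exists h.
rewrite mulnC -sum_nat_const; apply: leq_sum => v /attachedP[vo _].
apply: leq_trans (_ : #|[set h in own i | v \in h]| <= _).
  by apply/subset_leq_card/subsetP => h /setIdP[ho /andP[vh _]]; apply/setIdP.
apply: (own_through_le (S := [set v])); last by rewrite cards1.
move=> h ho vh; have he : h != e i.
  by apply: contraTneq vh => ->; apply: outsideN.
have /eqP/cards1P[w hw] := cap1 h ho he.
suff -> : v = w by [].
by apply/set1P; rewrite -hw inE vh.
Qed.

Lemma card_outside : #|X| = 3 * k + #|outside|.
Proof.
have sub : \bigcup_i e i \subset X.
  by apply/bigcupsP => i _; apply/subsetP => v; apply: edge_sub (eH i).
rewrite -(cardsID (\bigcup_i e i) X) (setIidPr sub); congr (_ + _).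
rewrite -sum1_card partition_disjoint_bigcup //.
under eq_bigr => i _ do rewrite sum1_card (edge_card3 (eH i)).
by rewrite sum_nat_const card_ord mulnC.
Qed.

(** Everything is doubled so that bridges can be summed over ordered pairs: a bridge of [e i] and
    [e j] is seen from both ends. *)
Lemma card_edges_le :
  2 * #|H| <= 2 * (\sum_i #|own i|) +
    \sum_i \sum_(j | j != i) #|bridge H (e i) (e j)|.
Proof.
have -> : 2 * #|H| = \sum_(h in H) 2 by rewrite sum_nat_const mulnC.
have -> : 2 * (\sum_i #|own i|) = \sum_(h in H) \sum_i 2 * (h \in own i).
  rewrite exchange_big big_distrr /=; apply: eq_bigr => i _.
  rewrite -sum1_card big_distrr /= [RHS]big_mkcond [LHS]big_mkcond /=.
  apply: eq_bigr => h _; case: (boolP (h \in own i)) => ho.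
    by rewrite (own_H ho).
  by rewrite muln0; case: ifP.
have -> : \sum_i \sum_(j | j != i) #|bridge H (e i) (e j)| =
    \sum_(h in H) \sum_i \sum_(j | j != i) (h \in bridge H (e i) (e j)).
  rewrite exchange_big; apply: eq_bigr => i _; rewrite exchange_big; apply: eq_bigr => j _.
  rewrite -sum1_card [RHS]big_mkcond [LHS]big_mkcond /=; apply: eq_bigr => h _.
  by case: ifP => [/setIdP[-> _]|_] //; case: ifP.
rewrite -big_split /=; apply: leq_sum => h hH.
have [i mi] := e_meet hH; have [ho|hn] := boolP (h \in own i).
  by rewrite (bigD1 i) //= ho muln1 -addnA leq_addr.
have /existsP[j /andP[ji mj]] : [exists j, (j != i) && ~~ [disjoint h & e j]].
  rewrite -[X in is_true X]negbK negb_exists; apply: contraNN hn => /forallP P.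
  apply/ownP; split=> // j ji; have := P j; rewrite ji /= negbK //.
have G a c : c != a -> ~~ [disjoint h & e a] -> ~~ [disjoint h & e c] ->
    0 < \sum_(l | l != a) (h \in bridge H (e a) (e l)).
  move=> ca ma mc; rewrite (bigD1 c) //= addn_gt0.
  by have -> : h \in bridge H (e a) (e c) by apply/setIdP; rewrite ma mc.
apply: (@leq_trans (\sum_a \sum_(l | l != a) (h \in bridge H (e a) (e l))));
  last exact: leq_addl.
rewrite (bigD1 i) //= [X in _ + X](bigD1 j) //= addnA.
apply: leq_trans (leq_addr _ _); apply: (@leq_add 1 1); first exact: G ji mi mj.
by apply: G mj mi; rewrite eq_sym.
Qed.
End Matching.

Lemma card_neq_ord k (i : 'I_k) : #|[pred j | j != i]| = k - 1.
Proof.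
have <- : #|~: [set i]| = k - 1 by rewrite cardsCs setCK cards1 card_ord.
by apply: eq_card => l; rewrite !inE.
Qed.

(** Averaging over ordered triples of distinct indices: each of the three terms sums to k - 2 times
    the pair sum. *)
Lemma sum_pairs_le k (b : 'I_k -> 'I_k -> nat) c : 2 < k ->
  (forall i j l, i != j -> i != l -> j != l -> b i j + b i l + b j l <= 3 * c) ->
  \sum_i \sum_(j | j != i) b i j <= c * (k * (k - 1)).
Proof.
move=> k3 P; set S := \sum_i _.
have others (i j : 'I_k) : i != j -> #|[pred l | (l != i) && (l != j)]| = k - 2.
  move=> ij; have <- : #|~: [set i; j]| = k - 2 by rewrite cardsCs setCK cards2 ij card_ord.
  by apply: eq_card => l; rewrite !inE negb_or.
have sum2 (i : 'I_k) : \sum_(j | j != i) \sum_(l | (l != i) && (l != j)) b i l =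
    (k - 2) * \sum_(l | l != i) b i l.
  rewrite (exchange_big_dep (fun l => l != i)) /=; last by move=> j l _ /andP[].
  rewrite big_distrr /=; apply: eq_bigr => l li.
  rewrite sum_nat_const; congr (_ * _); have il : i != l by rewrite eq_sym.
  by rewrite -(others i l il); apply: eq_card => j; rewrite !unfold_in /= li [l == j]eq_sym.
have s1 : \sum_i \sum_(j | j != i) \sum_(l | (l != i) && (l != j)) b i j = (k - 2) * S.
  rewrite /S big_distrr /=; apply: eq_bigr => i _; rewrite big_distrr /=.
  by apply: eq_bigr => j ji; rewrite sum_nat_const others // eq_sym.
have s2 : \sum_i \sum_(j | j != i) \sum_(l | (l != i) && (l != j)) b i l = (k - 2) * S.
  by rewrite /S big_distrr /=; apply: eq_bigr => i _; apply: sum2.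
have s3 : \sum_i \sum_(j | j != i) \sum_(l | (l != i) && (l != j)) b j l = (k - 2) * S.
  rewrite (exchange_big_dep xpredT) //= -s2; apply: eq_bigr => j _.
  apply: eq_big => [i|i ij]; first by rewrite eq_sym.
  by apply: eq_bigl => l; rewrite andbC.
have : \sum_i \sum_(j | j != i) \sum_(l | (l != i) && (l != j)) (b i j + b i l + b j l)
    <= \sum_(i < k) \sum_(j < k | j != i) \sum_(l < k | (l != i) && (l != j)) 3 * c.
  apply: leq_sum => i _; apply: leq_sum => j ji; apply: leq_sum => l /andP[li lj].
  by apply: P; rewrite eq_sym.
under eq_bigr => i _ do under eq_bigr => j _ do rewrite !big_split /=.
under eq_bigr => i _ do rewrite !big_split /=.
rewrite !big_split /= s1 s2 s3.
have -> : \sum_(i < k) \sum_(j < k | j != i) \sum_(l < k | (l != i) && (l != j)) 3 * c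
    = k * ((k - 1) * ((k - 2) * (3 * c))).
  rewrite (eq_bigr (fun=> (k - 1) * ((k - 2) * (3 * c)))) ?sum_nat_const ?card_ord // => i _.
  rewrite -(card_neq_ord i) -sum_nat_const; apply: eq_bigr => j ji.
  by rewrite sum_nat_const others // eq_sym.
have k2 : 0 < k - 2 by rewrite subn_gt0.
move=> le; rewrite -(leq_pmul2l k2) -(leq_pmul2l (isT : 0 < 3)).
by move: le; clear; move: (k - 2) (k - 1) => a d; nia.
Qed.

Lemma sum_pairs_le_const k (b : 'I_k -> 'I_k -> nat) c :
  (forall i j, j != i -> b i j <= c) ->
  \sum_i \sum_(j | j != i) b i j <= c * (k * (k - 1)).
Proof.
move=> P; apply: (@leq_trans (\sum_(i < k) \sum_(j < k | j != i) c)).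
  by apply: leq_sum => i _; apply: leq_sum => j; apply: P.
rewrite (eq_bigr (fun=> (k - 1) * c)) ?sum_nat_const ?card_ord; last first.
  by move=> i _; rewrite sum_nat_const; congr (_ * _); rewrite -(card_neq_ord i).
by rewrite mulnA mulnC leqnn.
Qed.

Section MaximumMatching.
Variables (T : finType) (X : {set T}) (H : {set {set T}}).
Hypothesis HX : H \subset triples X.

(** Both properties are exchange arguments: an edge disjoint from the whole matching could be added,
    and two disjoint edges meeting only [e i] could replace [e i]. *)
Lemma maximum_matching : exists k (e : 'I_k -> {set T}),
  [/\ forall i, e i \in H, forall i j, i != j -> [disjoint e i & e j],
      forall h, h \in H -> exists i, ~~ [disjoint h & e i]
    & forall i, intersecting (own H e i)].
Proof.
pose P (M : {set {set T}}) := (M \subset H) && trivIset M.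
have P0 : P set0 by rewrite /P sub0set; apply/trivIsetP => A B; rewrite inE.
case: (arg_maxnP (fun M : {set {set T}} => #|M|) P0) => M /andP[MH tM] maxM.
have n0 (M' : {set {set T}}) : M' \subset H -> set0 \notin M'.
  move=> sub; apply/negP => s0; have [] := triplesP HX (subsetP sub _ s0).
  by rewrite cards0.
have add h (M' : {set {set T}}) : h \in H -> P M' -> (forall g, g \in M' -> [disjoint h & g]) ->
    P (h |: M') /\ h \notin M'.
  move=> hH /andP[MH' tM'] d; have [t hM'] := trivIsetU1 d tM' (n0 _ MH').
  by rewrite /P t subUset sub1set hH MH'.
exists #|M|, (@enum_val _ (mem M)); split.
- by move=> i; apply: (subsetP MH); apply: enum_valP.
- move=> i j ij; move/trivIsetP: tM; apply; try exact: enum_valP.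
  by apply: contra ij => /eqP/enum_val_inj ->.
- move=> h hH; apply/existsP; rewrite -[X in is_true X]negbK negb_exists.
  apply/negP => /forallP d; have [||Ph hM] := add h M hH.
  + by rewrite /P MH.
  + move=> g gM; have := d (enum_rank_in gM g); rewrite negbK enum_rankK_in //.
  by have : #|h |: M| <= #|M| := maxM _ Ph; rewrite cardsU1 hM add1n ltnn.
move=> i g h go ho; apply/negP => dgh.
have [gH _ dg] := ownP _ _ _ _ go; have [hH _ dh] := ownP _ _ _ _ ho.
pose M1 := M :\ enum_val i.
have dM1 f : f \in own H (@enum_val _ (mem M)) i -> forall f', f' \in M1 -> [disjoint f & f'].
  move=> /ownP[_ _ df] f' /setD1P[ne f'M]; rewrite -(enum_rankK_in f'M f'M).
  apply: df; apply: contra ne => /eqP <-; rewrite enum_rankK_in //.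
have P1 : P M1.
  rewrite /P (subset_trans (subD1set _ _) MH) /=.
  by apply: trivIsetS tM; apply: subD1set.
have [P2 h1] := add h M1 hH P1 (dM1 h ho).
have [|P3 g2] := add g (h |: M1) gH P2.
  by move=> f /setU1P[->|fM] //; apply: dM1.
have : #|g |: (h |: M1)| <= #|M| := maxM _ P3; rewrite !cardsU1 h1 g2 (cardsD1 (enum_val i) M) enum_valP.
by rewrite !add1n ltnn.
Qed.
End MaximumMatching.

(** The worst distribution of outside vertices is found by enumeration because [phi] is not convex:
    it takes the values 1, 4, 10, 10, 17 at 0, ..., 4. *)
Fixpoint best (g : nat -> nat) k r : nat :=
  if k is k'.+1 then 
    foldr maxn 0 [seq g a + best g k' (r - a) | a <- iota 0 r.+1]
  else 0.

Lemma leq_foldr_maxn s m : m \in s -> m <= foldr maxn 0 s.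
Proof.
elim: s => //= a s IH; rewrite inE leq_max => /orP[/eqP->|/IH ->].
  by rewrite leqnn.
by rewrite orbT.
Qed.

Lemma sum_le_best g k r (u : 'I_k -> nat) : \sum_i u i <= r -> \sum_i g (u i) <= best g k r.
Proof.
elim: k r u => [|k IH] r u; first by rewrite !big_ord0.
rewrite !big_ord_recl => le; rewrite [best _ _ _]/best -/best.
apply: leq_trans (_ : g (u ord0) + best g k (r - u ord0) <= _).
  by rewrite leq_add2l; apply: IH; rewrite -(leq_add2l (u ord0)) subnKC // (leq_trans _ le) ?leq_addr.
apply: leq_foldr_maxn; apply/mapP; exists (u ord0) => //.
by rewrite mem_iota add0n ltnS (leq_trans _ le) ?leq_addr.
Qed.

(* Meaningful for [7 <= n <= 15]: [n - 6] systems of this size leave at least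
   [16 - n] triples of [n] points uncovered.  For [n = 12] more is left, to make room
   for systems split by a 6-set. *)
Definition threshold n := nth 0 [:: 20; 24; 25; 28; 32; 32; 40; 45; 50] (n - 7).

(** The summand 2 * (k * (k - 1)) stands for the bridges, four on average for each pair of matching
    edges; at most five disjoint edges fit into 15 points. *)
Definition many_numeric :=
  all (fun n => all (fun k => (3 * k <= n) ==>
    all (fun x => best (psi x) k (n - 3 * k - x) + 2 * (k * (k - 1)) <= threshold n)
      (iota 0 (n - 3 * k).+1)) (iota 3 3)) (iota 7 9).

(* [100] stands for no restriction. *)
Definition degree_cap n := if n < 14 then 100 else 3 * n - 6.

(** The summand 3 is the bound of [bridge_le3]. The cap is necessary from n = 14 on: with eight
    private vertices at one edge, [phi] allows a star of 45 there, and 45 + 1 + 3 exceeds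
    [threshold 14 = 45]. *)
Definition two_numeric :=
  all (fun n => all (fun x =>
      best (fun u => minn (psi x u) (degree_cap n)) 2 (n - 6 - x) + 3 <= threshold n)
    (iota 0 (n - 6).+1)) (iota 7 9).

Lemma many_numericP n k x : 7 <= n <= 15 -> 2 < k -> 3 * k <= n -> x <= n - 3 * k ->
  best (psi x) k (n - 3 * k - x) + 2 * (k * (k - 1)) <= threshold n.
Proof.
move=> n7 k3 kn xr; have /allP/(_ n) : many_numeric by vm_compute.
rewrite mem_iota => /(_ n7)/allP/(_ k); rewrite mem_iota.
have -> : 3 <= k < 3 + 3 by move: n7 k3 kn; clear; lia.
rewrite kn => /(_ isT)/allP; apply; by rewrite mem_iota add0n ltnS.
Qed.

Lemma two_numericP n x : 7 <= n <= 15 -> x <= n - 6 ->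
  best (fun u => minn (psi x u) (degree_cap n)) 2 (n - 6 - x) + 3 <= threshold n.
Proof.
move=> n7 xr; have /allP/(_ n) : two_numeric by vm_compute.
rewrite mem_iota => /(_ n7)/allP; apply; by rewrite mem_iota add0n ltnS.
Qed.

Lemma threshold_ge n : 7 <= n <= 15 -> (3 * n - 6 <= threshold n) && (20 <= threshold n).
Proof.
move=> n7; have /allP/(_ n) : all (fun n => (3 * n - 6 <= threshold n) && (20 <= threshold n)) (iota 7 9).
  by vm_compute.
by rewrite mem_iota; apply.
Qed.

(** * Path-free systems without a splitting 6-set *)

Section Threshold.
Variables (T : finType) (X : {set T}) (H : {set {set T}}).
Hypothesis Hfree : pfree H.
Hypothesis HX : H \subset triples X.
Implicit Types (v w : T) (f g h z : {set T}).

Definition split_at (W : {set T}) := [forall h in H, (h \subset W) || [disjoint h & W]].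

Definition split6 := [exists W : {set T}, [&& W \subset X, #|W| == 6 & split_at W]].

Lemma bridge_le9_split e f : e \in H -> f \in H -> [disjoint e & f] -> ~~ split6 ->
  #|bridge H e f| <= 9.
Proof.
move=> eH fH def; rewrite negb_exists => /forallP/(_ (e :|: f)).
have [e3 /subsetP eX] := triplesP HX eH; have [f3 /subsetP fX] := triplesP HX fH.
rewrite subUset eX fX /= cardsU e3 f3 disjoint_setI0 // cards0 /=.
rewrite negb_forall_in => /exists_inP[h hH]; rewrite negb_or => /andP[hn hm].
apply: (bridge_le9 Hfree) hm hn => //; exact: edge_card3 HX.
Qed.

(** If at most one pair is bridged, its 9 bridges are all there is. Otherwise two bridged pairs have
    a matching edge in common, and [bridge_triangle] applies after renaming. *)
Lemma three_bridges_le12 e f g : e \in H -> f \in H -> g \in H ->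
  [disjoint e & f] -> [disjoint e & g] -> [disjoint f & g] -> ~~ split6 ->
  #|bridge H e f| + #|bridge H e g| + #|bridge H f g| <= 12.
Proof.
move=> eH fH gH ef eg fg ns; have H3 := edge_card3 HX.
have [fe [ge gf]] : [disjoint f & e] /\ ([disjoint g & e] /\ [disjoint g & f]).
  by rewrite disjoint_sym ef disjoint_sym eg disjoint_sym.
have [bef|bef] := set_0Vmem (bridge H e f).
  have [beg|beg] := set_0Vmem (bridge H e g).
    by rewrite bef beg !cards0 (leq_trans (bridge_le9_split fH gH fg ns)).
  have [bfg|bfg] := set_0Vmem (bridge H f g).
    by rewrite bef bfg !cards0 addn0 (leq_trans (bridge_le9_split eH gH eg ns)).
  have := bridge_triangle Hfree H3 gH eH fH ge gf ef.
  rewrite ![bridge H g _]bridgeC addnC addnA; apply.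
    by case: beg => h hb; apply/set0Pn; exists h.
  by case: bfg => h hb; apply/set0Pn; exists h.
have nef : bridge H e f != set0 by case: bef => h hb; apply/set0Pn; exists h.
have [beg|beg] := set_0Vmem (bridge H e g).
  have [bfg|bfg] := set_0Vmem (bridge H f g).
    by rewrite beg bfg !cards0 !addn0 (leq_trans (bridge_le9_split eH fH ef ns)).
  have := bridge_triangle Hfree H3 fH eH gH fe fg eg.
  rewrite [bridge H f e]bridgeC addnAC; apply=> //.
  by case: bfg => h hb; apply/set0Pn; exists h.
apply: (bridge_triangle Hfree H3) => //.
by case: beg => h hb; apply/set0Pn; exists h.
Qed.

Section Matched.
Variables (k : nat) (e : 'I_k -> {set T}).
Hypothesis eH : forall i, e i \in H.
Hypothesis e_disj : forall i j, i != j -> [disjoint e i & e j].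
Hypothesis e_meet : forall h, h \in H -> exists i, ~~ [disjoint h & e i].
Hypothesis own_meet : forall i, intersecting (own H e i).
Hypothesis X7 : 7 <= #|X| <= 15.
Hypothesis nsplit : ~~ split6.

Let r := #|outside X e|.
Let x := #|shared X H e|.

Lemma card_X : #|X| = 3 * k + r.
Proof. by rewrite (card_outside HX eH e_disj). Qed.

Lemma shared_le : x <= r.
Proof. by apply: leq_trans (sum_private X H e); apply: leq_addl. Qed.

Lemma sum_private_le : \sum_i #|private X H e i| <= r - x.
Proof.
by rewrite -(leq_add2r x) subnK ?shared_le //; apply: sum_private.
Qed.

Lemma le_threshold_many : 2 < k -> #|H| <= threshold #|X|.
Proof.
move=> k3; have kX : 3 * k <= #|X| by rewrite card_X leq_addr.
have rE : r = #|X| - 3 * k by rewrite card_X addKn.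
have := many_numericP X7 k3 kX; move=> /(_ x); rewrite -rE => /(_ shared_le).
apply: leq_trans; rewrite -(leq_pmul2l (isT : 0 < 2)).
apply: leq_trans (card_edges_le e_meet) _; rewrite mulnDr leq_add //.
  rewrite leq_mul2l /=; apply: leq_trans (sum_le_best _ sum_private_le).
  by apply: leq_sum => i _; apply: own_le.
rewrite mulnA; apply: sum_pairs_le => // i j l ij il jl.
by apply: three_bridges_le12 => //; apply: e_disj.
Qed.

Lemma pair_edges_le b : k = 2 -> (forall i j, j != i -> #|bridge H (e i) (e j)| <= b) ->
  #|H| <= \sum_i #|own H e i| + b.
Proof.
move=> k2 le_b; rewrite -(leq_pmul2l (isT : 0 < 2)).
apply: leq_trans (card_edges_le e_meet) _; rewrite mulnDr leq_add2l.
by apply: leq_trans (sum_pairs_le_const le_b) _; rewrite k2 mulnC leqnn.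
Qed.

Lemma pair_eq i j a c : k = 2 -> i != j -> a != c :> 'I_k ->
  (a = i /\ c = j) \/ (a = j /\ c = i).
Proof.
rewrite -!val_eqE /= => k2 ij ac.
have lt2 (l : 'I_k) : l < 2 by apply: leq_trans (ltn_ord l) _; rewrite k2.
have [[i2 j2] [a2 c2]] := ((lt2 i, lt2 j), (lt2 a, lt2 c)).
have [ai|ai] := eqVneq (a : nat) i; [left|right]; split; apply: val_inj => //=;
  by move: i2 j2 a2 c2 ij ac ai => /=; clear; lia.
Qed.

(** An edge with two vertices outside has exactly one in [e i] and misses the other matching edge,
    so there are at most 3 bridges instead of 9. *)
Lemma le_threshold_thick i h : k = 2 -> h \in own H e i -> 1 < #|h :&: outside X e| ->
  (14 <= #|X| -> forall v, #|[set h in H | v \in h]| <= 3 * #|X| - 6) ->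
  #|H| <= threshold #|X|.
Proof.
move=> k2 ho thick deg; have rE : r = #|X| - 6 by rewrite card_X k2 addKn.
have H3 := edge_card3 HX.
have he1 : #|h :&: e i| = 1.
  have := own_cap HX ho; have := own_cap_gt0 ho.
  by move: thick; clear; move: #|_ :&: e i| #|_ :&: outside _ _| => a b; lia.
have [hH _ hd] := ownP _ _ _ _ ho.
have le3 a c : c != a -> #|bridge H (e a) (e c)| <= 3.
  move=> ca; have [j ji] : exists j, j != i.
    by have [->|ai] := eqVneq i a; [exists c|exists a; rewrite eq_sym].
  have lei : #|bridge H (e i) (e j)| <= 3.
    by apply: (bridge_le3 Hfree H3 (eH i) (eH j) hH _ he1); [rewrite e_disj // eq_sym|exact: hd].
  by have [[-> ->]|[-> ->]] := pair_eq k2 ji ca; rewrite ?lei // bridgeC.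
apply: leq_trans (pair_edges_le k2 le3) _.
have := two_numericP X7; move=> /(_ x); rewrite -rE => /(_ shared_le).
apply: leq_trans; rewrite leq_add2r -k2; apply: leq_trans (sum_le_best _ sum_private_le).
apply: leq_sum => a _; rewrite leq_min own_le //= /degree_cap.
have X6 : #|X| = 6 + r by rewrite card_X k2.
case: ltnP => X14.
  apply: leq_trans (own_le Hfree HX eH own_meet a) _.
  have : x + #|private X H e a| <= 7.
    apply: leq_trans (_ : r <= _); last by move: X6 X14; clear; lia.
    rewrite -(subnKC shared_le) leq_add2l; apply: leq_trans sum_private_le.
    by rewrite (bigD1 a) //= leq_addr.
  rewrite -/x; move: x #|private _ _ _ _|; clear => x u xu.
  (* Fewer than 14 points leave at most seven outside the matching, and then the cap 100 never
     binds. *)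
  have : all (fun x => all (fun u => psi x u <= 100) (iota 0 8)) (iota 0 8) by vm_compute.
  by move=> /allP/(_ x) => /(_ _)/allP; apply; rewrite mem_iota; move: xu; lia.
apply: (own_le_degree HX eH own_meet); first exact: deg X14;
  by rewrite -/r; move: X6 X14; clear; lia.
Qed.

(** Up to 9 bridges are affordable here because the edges at each [e i] grow only linearly: without
    shared vertices the total is at most 2 + 3r + 9 = 3n - 7, where r = n - 6. *)
Lemma le_threshold_thin : k = 2 ->
  (forall i h, h \in own H e i -> #|h :&: outside X e| <= 1) ->
  #|H| <= threshold #|X|.
Proof.
move=> k2 thin; have X6 : #|X| = 6 + r by rewrite card_X k2.
have le9 a c : c != a -> #|bridge H (e a) (e c)| <= 9.
  by move=> ca; apply: bridge_le9_split; rewrite ?e_disj // eq_sym.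
apply: leq_trans (pair_edges_le k2 le9) _.
have /andP[t1 t2] := threshold_ge X7.
have [x0|x0] := posnP x.
  have le i : #|own H e i| <= 1 + 3 * #|private X H e i|.
    apply: leq_trans (own_thin_le HX eH (thin i)) _; rewrite ltnS leq_mul2l.
    by have := attached_le X H e i; rewrite -/x x0 addn0.
  have : \sum_i #|own H e i| <= 2 + 3 * r.
    apply: (@leq_trans (\sum_i (1 + 3 * #|private X H e i|))).
      by apply: leq_sum => i _; apply: le.
    rewrite big_split sum1_card card_ord -big_distrr /=; apply: leq_add; first by rewrite k2.
    rewrite leq_mul2l /=.
    by apply: leq_trans sum_private_le _; apply: leq_subr.
  by move: t1 X6; clear; lia.
(* There are just two matching edges, so a shared vertex is attached to both; thin edges through it
   make [own_single_le] available at each of them. *)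
have [v vs] : exists v, v \in shared X H e by apply/set0Pn; rewrite -card_gt0.
have le i : #|own H e i| <= (maxn 3 r).+1.
  have [a [c [ac va vc]]] : exists a c, [/\ a != c, v \in attached X H e a & v \in attached X H e c].
    move: vs; rewrite inE => /andP[_ /existsP[a /existsP[c /and3P[]]]].
    by exists a, c.
  have /attachedP[vo [h ho vh]] : v \in attached X H e i.
    have [j ji] : exists j, j != i.
      by have [->|ai] := eqVneq i a; [exists c; rewrite eq_sym|exists a; rewrite eq_sym].
    by have [[_ <-]|[<- _]] := pair_eq k2 ji ac.
  have cap1 : #|h :&: outside X e| = 1.
    apply/eqP; rewrite eqn_leq (thin i h ho) card_gt0; apply/set0Pn.
    by exists v; rewrite inE vh.
  have hs : ~~ [disjoint h & shared X H e] by apply/meetP; exists v.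
  have [_ le] := single_in_shared Hfree HX eH own_meet ho cap1 hs.
  apply: leq_trans le _; rewrite ltnS geq_max leq_maxl leq_max.
  apply/orP; right; apply/subset_leq_card/subsetP => w /attachedP[] //.
have : \sum_i #|own H e i| <= 2 * (maxn 3 r).+1.
  apply: (@leq_trans (\sum_(i < k) (maxn 3 r).+1)).
    by apply: leq_sum => i _; apply: le.
  by rewrite sum_nat_const card_ord k2.
by move: t1 t2 X6 X7; clear; lia.
Qed.
End Matched.
End Threshold.

(** * A vertex of large degree *)

Section LargeDegree.
Variables (T : finType) (X : {set T}) (H : {set {set T}}) (x : T).
Hypothesis Hfree : pfree H.
Hypothesis HX : H \subset triples X.
Hypothesis X14 : 14 <= #|X| <= 15.
Hypothesis xX : x \in X.
Implicit Types (v w : T) (f g h y z : {set T}).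

Let L := [set h in H | x \in h].
Let Y := [set h in H | x \notin h].

Hypothesis deg_x : 3 * #|X| - 6 < #|L|.

Let L3 h : h \in L -> [/\ h \in H, #|h| = 3, x \in h & {subset h <= X}].
Proof. by move=> /setIdP[hH xh]; have [] := triplesP HX hH. Qed.

Let Y3 y : y \in Y -> [/\ y \in H, #|y| = 3, x \notin y & {subset y <= X}].
Proof. by move=> /setIdP[hH xh]; have [] := triplesP HX hH. Qed.

Lemma codegree_x_le v : v \in X -> x != v -> #|[set h in L | v \in h]| <= #|X| - 2.
Proof.
move=> vX xv; rewrite -(cardsD2 xX vX xv); apply: (codegree_le xv) => h.
move=> /setIdP[/L3[_ h3 xh hX] vh]; have [w /and3P[wh wx wv]] := third h3 xv xh vh.
by split=> //; exists w; rewrite !inE wh wx wv hX.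
Qed.

(* Say [h] meets [y] in one vertex and [u] is its third vertex.  Every other edge
   at [x] meets [y] or contains [u], which leaves room for few of them. *)
Lemma link_separated h y : h \in L -> y \in Y -> #|h :&: y| != 1.
Proof.
move=> hL yY; have [hH h3 xh hX] := L3 hL; have [yH y3 xy yX] := Y3 yY.
have cap z v : z \in L -> z :&: y = [set v] -> exists2 u, z =i [:: x; v; u] & u \notin y.
  move=> zL zv; have [zH z3 xz _] := L3 zL.
  have /setIP[vz vy] : v \in z :&: y by rewrite zv set11.
  have xv : x != v by apply: contraNneq xy => ->.
  have [u /and3P[uz ux uv]] := third z3 xv xz vz; exists u; last first.
    by apply: contra uv => uy; rewrite -in_set1 -zv inE uz.
  have /eqP zE : [set x; v; u] == z.
    rewrite eqEcard z3 setUC cardsU1 cards2 xv !inE negb_or ux uv leqnn andbT.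
    by apply/subsetP => w; rewrite !inE => /or3P[] /eqP->.
  by move=> w; rewrite -zE !inE orbA.
have through z v u q : z \in L -> z :&: y = [set v] -> z =i [:: x; v; u] -> q \in L ->
    [disjoint q & y] -> u \in q.
  move=> zL zv zE qL dqy; have [[zH z3 xz _] [qH q3 xq _]] := (L3 zL, L3 qL).
  apply: contraT => uq; move/pfreeP: Hfree => /(_ q z y qH zH yH).
  rewrite /is_path zv cards1 eqxx dqy !andbT => /negP; case.
  apply/cards1P; exists x; apply/setP => w; rewrite !inE.
  apply/andP/eqP => [[wq]|->]; last by rewrite xq xz.
  rewrite zE !inE => /or3P[] /eqP // wE; last by rewrite -wE wq in uq.
  have /setIP[_ vy] : v \in z :&: y by rewrite zv set11.
  by move/disjP: dqy => /(_ w wq); rewrite wE vy => /(_ isT).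
apply/negP => /cards1P[v hv]; have [u hE uy] := cap h v hL hv.
have xy' w : w \in y -> x != w by move=> wy; apply: contraNneq xy => ->.
have [/existsP[q /andP[qL dqy]]|nex] := boolP [exists q, (q \in L) && [disjoint q & y]].
  have [qH q3 xq qX] := L3 qL; have uq := through h v u q hL hv hE qL dqy.
  have ux : x != u.
    have := h3; apply: contra_eqN => /eqP E; rewrite neq_ltn; apply/orP; left.
    apply: leq_ltn_trans (_ : _ <= #|[set x; v]|) _; last by rewrite cards2; case: eqP.
    apply/subset_leq_card/subsetP => w; rewrite hE !inE -E.
    by case: eqP => //= _; rewrite orbF.
  move: deg_x; rewrite ltnNge => /negP; apply.
  apply: leq_trans (_ : #|[set h in L | u \in h]| + #|[set h in L | h :\ x \subset y :|: (q :\ x)]| <= _).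
    apply: card_setU_le; apply/subsetP => z zL; rewrite in_setU.
    have [zH z3 xz zX] := L3 zL.
    have [dzy|mzy] := boolP [disjoint z & y].
      by apply/orP; left; apply/setIdP; split=> //; apply: through hL hv hE zL dzy.
    apply/orP; right; apply/setIdP; split=> //; have [/cards1P[v' zv']|c2] := boolP (#|z :&: y| == 1).
      have [u' zE' _] := cap z v' zL zv'.
      have u'q := through z v' u' q zL zv' zE' qL dqy.
      have /setIP[_ vy'] : v' \in z :&: y by rewrite zv' set11.
      apply/subsetP => w; rewrite !inE zE' !inE => /andP[wx].
      by rewrite (negPf wx) /= => /orP[] /eqP ->; rewrite ?vy' ?u'q ?orbT // -?zE'.
    suff /eqP <- : z :&: y == z :\ x by apply: subset_trans (subsetIr _ _) (subsetUl _ _).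
    rewrite eqEcard; apply/andP; split.
      apply/subsetP => w /setIP[wz wy]; rewrite !inE wz andbT eq_sym; exact: xy'.
    have := z3; rewrite (cardsD1 x) xz add1n => -[->].
    have : #|z :&: y| != 0 by rewrite cards_eq0 setI_eq0.
    by move: #|z :&: y| c2; clear; case=> [|[|]].
  apply: leq_trans (leq_add (codegree_x_le (qX _ uq) ux) (@card_link_le _ (y :|: (q :\ x)) _ x _)) _.
    by move=> z /setIdP[/L3[]].
  (* Edges at [x] not through [u] have their other two vertices in this 5-set, so there are at most
     10 of them, besides the |X| - 2 through [u]. *)
  have c5 : #|y :|: (q :\ x)| <= 5.
    rewrite cardsU; apply: leq_trans (leq_subr _ _) _; rewrite y3.
    by have := q3; rewrite (cardsD1 x) xq add1n => -[->].
  have := leq_bin2l 2 c5; move: X14; clear; rewrite (_ : 'C(5, 2) = 10) //; lia.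
(* Now every edge at [x] passes through one of the three vertices of [y], which gives at most 3 (|X|
   - 2). This is the degree bound 3 |X| - 6. *)
have [a [b [c [_ yE]]]] := card3P y3.
move: deg_x; rewrite ltnNge => /negP; apply.
pose C v := [set h in L | v \in h].
apply: leq_trans (_ : #|C a| + #|C b :|: C c| <= _).
  apply: card_setU_le; apply/subsetP => z zL; rewrite !in_setU.
  move: nex; rewrite negb_exists => /forallP/(_ z); rewrite zL => /meetP[w wz wy].
  have zC : z \in C w by apply/setIdP.
  by move: wy; rewrite yE 3!in_cons in_nil orbF => /or3P[] /eqP <-; rewrite zC ?orbT.
apply: leq_trans (leq_add (leqnn _) (card_setU_le (subxx _))) _.
have le w : w \in y -> #|C w| <= #|X| - 2 by move=> wy; apply: codegree_x_le; rewrite ?yX ?xy'.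
apply: leq_trans (leq_add (le a _) (leq_add (le b _) (le c _))) _; try by rewrite yE !inE eqxx ?orbT.
by move: X14; clear; lia.
Qed.

Let U := cover Y.

Let L_in := [set h in L | ~~ [disjoint h & U]].

Let xU : x \notin U.
Proof. by apply/bigcupP => -[y /Y3[_ _ /negP]]. Qed.

Lemma link_cap h y : h \in L -> y \in Y -> ~~ [disjoint h & y] -> h :\ x \subset y.
Proof.
move=> hL yY m; have [hH h3 xh hX] := L3 hL; have [yH y3 xy yX] := Y3 yY.
suff /eqP <- : h :&: y == h :\ x by apply: subsetIr.
rewrite eqEcard; apply/andP; split.
  apply/subsetP => w /setIP[wh wy]; rewrite !inE wh andbT.
  by apply: contraNneq xy => <-.
have := h3; rewrite (cardsD1 x) xh add1n => -[->].
have := link_separated hL yY; rewrite -setI_eq0 -cards_eq0 in m.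
by move: #|h :&: y| m; clear; case=> [|[|]].
Qed.

Lemma L_inP h : h \in L_in -> h \in L /\ h :\ x \subset U.
Proof.
case/setIdP => hL /meetP[v vh /bigcupP[y yY vy]]; split=> //.
apply: subset_trans (bigcup_sup y yY); apply: link_cap => //.
by apply/meetP; exists v.
Qed.

(** The pairs [h :\ x] form a graph on [U] of maximum degree two: once such a pair meets an edge [y]
    in [v], it lies in [y], and its other end is one of the two remaining vertices of [y]. *)
Lemma card_L_in : #|L_in| <= #|U|.
Proof.
rewrite -(leq_pmul2r (isT : 0 < 2)) -!sum_nat_const.
have -> : \sum_(h in L_in) 2 = \sum_(h in L_in) #|h :&: U|.
  apply: eq_bigr => h /L_inP[hL sub]; have [hH h3 xh hX] := L3 hL.
  have -> : h :&: U = h :\ x.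
    apply/setP => w; rewrite !inE; have [->|wx] /= := eqVneq w x.
      by rewrite (negPf xU) andbF.
    by have [wh|//] := boolP (w \in h); rewrite (subsetP sub) // !inE wx.
  by have := h3; rewrite (cardsD1 x) xh add1n => -[->].
under eq_bigr do rewrite -sum1_card.
rewrite (exchange_big_dep (mem U)) /=; last by move=> h v _ /setIP[].
apply: leq_sum => v /bigcupP[y yY vy]; rewrite sum1_card.
have [yH y3 xy yX] := Y3 yY.
have xv : x != v by apply: contraNneq xy => ->.
have <- : #|y :\ v| = 2 by have := y3; rewrite (cardsD1 v) vy add1n => -[].
rewrite -cardsE; apply: (codegree_le xv) => h; rewrite inE => /andP[/L_inP[hL _] /setIP[vh _]].
have [hH h3 xh hX] := L3 hL; split=> //.
have [w /and3P[wh wx wv]] := third h3 xv xh vh; exists w; rewrite wh wx wv !inE wv !andbT.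
apply: (subsetP (link_cap hL yY _)); last by rewrite !inE wx wh.
by apply/meetP; exists v.
Qed.

Lemma card_L_out : #|L :\: L_in| <= 'C(#|X| - 1 - #|U|, 2).
Proof.
have -> : #|X| - 1 - #|U| = #|X :\ x :\: U|.
  rewrite cardsD (setIidPr _); last first.
    apply/subsetP => v /[dup] vU /bigcupP[y /Y3[_ _ _ yX] vy]; rewrite !inE yX // andbT.
    by apply: contraNneq xU => <-.
  by have := cardsD1 x X; rewrite xX => ->; rewrite addKn.
apply: (@card_link_le _ _ _ x) => h /setDP[hL hn]; have [hH h3 xh hX] := L3 hL.
split=> //; apply/subsetP => v; rewrite !inE => /andP[vx vh]; rewrite vx hX // !andbT.
by apply: contra hn => vU; apply/setIdP; split=> //; apply/meetP; exists v.
Qed.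

Lemma card_Y : #|Y| <= 'C(#|U|, 3).
Proof.
rewrite -card_triples; apply/subset_leq_card/subsetP => y yY.
have [_ y3 _ _] := Y3 yY; rewrite in_triples y3 eqxx andbT.
exact: bigcup_sup.
Qed.

(** For the pair {p, q} left of [h] after removing [x], every edge of [Y] contains both points or
    neither. *)
Lemma card_Y_twins h : h \in L_in -> #|Y| <= #|U| - 2 + 'C(#|U| - 2, 3).
Proof.
move=> /L_inP[hL sub]; have [hH h3 xh hX] := L3 hL.
have [p [q [pq hE]]] : exists p q, p != q /\ h :\ x = [set p; q].
  by apply: card2P; have := h3; rewrite (cardsD1 x) xh add1n => -[].
have [pU qU] : p \in U /\ q \in U by split; apply: (subsetP sub); rewrite hE !inE eqxx ?orbT.
have [/setD1P[px ph] /setD1P[qx qh]] : p \in h :\ x /\ q \in h :\ x.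
  by rewrite hE !inE !eqxx orbT.
rewrite -(cardsD2 pU qU pq) -card_triples.
have yU y : y \in Y -> {subset y <= U} by move=> yY w wy; apply/bigcupP; exists y.
apply: leq_trans (_ : #|[set y in Y | (p \in y) && (q \in y)]| +
  #|triples (U :\ p :\ q)| <= _); last first.
  rewrite leq_add2r; apply: (codegree_le pq) => y /setIdP[yY /andP[py qy]].
  have [_ y3 _ _] := Y3 yY; have [w /and3P[wy wp wq]] := third y3 pq py qy.
  by split=> //; exists w; rewrite wy wp wq !inE wp wq (yU y).
apply: card_setU_le; apply/subsetP => y yY; rewrite in_setU.
have [_ y3 _ _] := Y3 yY.
have [m|d] := boolP [disjoint h & y]; last first.
  have s := subsetP (link_cap hL yY d); apply/orP; left; apply/setIdP; split=> //.
  by rewrite !s // hE !inE eqxx ?orbT.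
apply/orP; right; rewrite in_triples y3 eqxx andbT; apply/subsetP => w wy.
rewrite !inE (yU y) // andbT; apply/andP; split.
  by apply/eqP => wq; move/disjP: m => /(_ w); rewrite wq qh -wq => /(_ isT wy).
by apply/eqP => wp; move/disjP: m => /(_ w); rewrite wp ph -wp => /(_ isT wy).
Qed.

(** In a 4-set a pair meets every triple, and by [link_cap] it is then contained in it; two
    different triples have at most one pair in common. *)
Lemma card_L_in4 : #|U| = 4 -> 1 < #|Y| -> #|L_in| <= 1.
Proof.
move=> U4 /card_gt1P[y1 [y2 [y1Y y2Y ne]]].
have [_ y13 _ _] := Y3 y1Y; have [_ y23 _ _] := Y3 y2Y.
have I2 : #|y1 :&: y2| <= 2.
  rewrite -ltnS -[3]y13; apply: proper_card; rewrite properE subsetIl.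
  apply: contra ne => /subsetIP[_ s]; by rewrite eqEcard s y13 y23.
apply: leq_trans (_ : #|[set h in L | h :\ x \subset y1 :&: y2]| <= _); last first.
  apply: leq_trans (@card_link_le _ (y1 :&: y2) _ x _) _.
    by move=> z /setIdP[/L3[]].
  by apply: leq_trans (leq_bin2l 2 I2) _.
apply/subset_leq_card/subsetP => h /L_inP[hL sub]; apply/setIdP; split=> //.
have [hH h3 xh hX] := L3 hL.
have inside y : y \in Y -> #|y| = 3 -> h :\ x \subset y.
  move=> yY y3; apply: link_cap => //; apply/negP => d.
  have : #|y :|: (h :\ x)| <= #|U|.
    by apply: subset_leq_card; rewrite subUset sub andbT; apply: bigcup_sup.
  rewrite cardsU disjoint_setI0 ?cards0 ?subn0 ?y3 ?U4.
    by have := h3; rewrite (cardsD1 x) xh add1n => -[->].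
  apply/disjP => w wy /setD1P[_ wh]; by move/disjP: d => /(_ w wh wy).
by rewrite subsetI !inside.
Qed.

Lemma large_degree_le : 1 < #|Y| -> #|H| <= threshold #|X|.
Proof.
move=> Y2; have HE : #|H| <= #|L| + #|Y|.
  by apply: card_setU_le; apply/subsetP => h hH; rewrite !inE hH; case: (x \in h).
have LE : #|L| <= 'C(#|X| - 1 - #|U|, 2) + #|L_in|.
  apply: leq_trans (leq_add card_L_out (leqnn _)); apply: card_setU_le.
  by apply/subsetP => h hL; rewrite in_setU in_setD hL andbT orNb.
have U4 : 4 <= #|U|.
  rewrite ltnNge; apply: contraL Y2 => U3; rewrite -leqNgt.
  apply: leq_trans card_Y _; exact: leq_trans (leq_bin2l 3 U3) _.
have UX : #|U| <= #|X| - 1.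
  have -> : #|X| - 1 = #|X :\ x| by rewrite (cardsD1 x X) xX addKn.
  apply/subset_leq_card/subsetP => v /[dup] vU /bigcupP[y /Y3[_ _ _ yX] vy].
  by rewrite !inE yX // andbT; apply: contraNneq xU => <-.
(* A large [U] leaves too few pairs outside it for the degree of [x], so only |U| = 4, and |U| = 5
   with 15 points, remain. *)
have small : #|U| <= #|X| - 10.
  rewrite leqNgt; apply/negP => big; move: deg_x; rewrite ltnNge => /negP; apply.
  apply: leq_trans LE _; apply: leq_trans (leq_add (leqnn _) card_L_in) _.
  have : all (fun n => all (fun u => 'C(n - 1 - u, 2) + u <= 3 * n - 6) (iota (n - 9) 9))
     [:: 14; 15] by vm_compute.
  move=> /allP/(_ #|X|); rewrite !inE => /(_ _)/allP; apply.
    by move: X14; clear; lia.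
  by rewrite mem_iota; move: big UX X14; clear; lia.
have [[X_14 U_4]|[X_15 [U_4|U_5]]] : (#|X| = 14 /\ #|U| = 4) \/
    (#|X| = 15 /\ (#|U| = 4 \/ #|U| = 5)) by move: small U4 X14; clear; lia.
- have := card_L_in4 U_4 Y2; have := card_Y; move: HE LE; rewrite X_14 U_4.
  rewrite (_ : 'C(14 - 1 - 4, 2) = 36) // (_ : 'C(4, 3) = 4) // (_ : threshold 14 = 45) //.
  by move: #|L| #|Y| #|L_in| #|H| => a b c d; clear; lia.
- have := card_L_in4 U_4 Y2; have := card_Y; move: HE LE; rewrite X_15 U_4.
  rewrite (_ : 'C(15 - 1 - 4, 2) = 45) // (_ : 'C(4, 3) = 4) // (_ : threshold 15 = 50) //.
  by move: #|L| #|Y| #|L_in| #|H| => a b c d; clear; lia.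
have [E|[h hL]] := set_0Vmem L_in.
  have := card_Y; move: HE LE; rewrite E cards0 X_15 U_5.
  rewrite (_ : 'C(15 - 1 - 5, 2) = 36) // (_ : 'C(5, 3) = 10) // (_ : threshold 15 = 50) //.
  by move: #|L| #|Y| #|H| => a b d; clear; lia.
have := card_Y_twins hL; have := card_L_in; move: HE LE; rewrite X_15 U_5.
rewrite (_ : 'C(15 - 1 - 5, 2) = 36) // (_ : 'C(5 - 2, 3) = 1) // (_ : threshold 15 = 50) //.
by move: #|L| #|Y| #|L_in| #|H| => a b c d; clear; lia.
Qed.
End LargeDegree.

(** * Near-stars, split systems and small systems *)

Section Classification.
Variables (T : finType).
Implicit Types (X W : {set T}) (H : {set {set T}}).

(** One exceptional edge has to be allowed. On 15 points, an edge y missing x and the 55 triples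
    formed by x and two of the 11 remaining points make a path-free system of 56 edges, more than
    [threshold 15 = 50]. *)
Definition near_star X H := exists2 x, x \in X & #|[set h in H | x \notin h]| <= 1.

Lemma star_near_star X H x : H \subset triples X -> X != set0 ->
  (forall h, h \in H -> x \in h) -> near_star X H.
Proof.
move=> HX /set0Pn[v vX] P; have [H0|[h hH]] := set_0Vmem H.
  exists v => //; suff -> : [set h in H | v \notin h] = set0 by rewrite cards0.
  by apply/setP => g; rewrite H0 !inE.
exists x; first by have [_] := triplesP HX hH; apply; apply: P.
suff -> : [set h in H | x \notin h] = set0 by rewrite cards0.
by apply/setP => g; rewrite !inE; have [/P ->|] := boolP (g \in H).
Qed.

Lemma pfree_classification X H : pfree H -> H \subset triples X -> 7 <= #|X| <= 15 ->
  [\/ near_star X H, split6 X H | #|H| <= threshold #|X|].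
Proof.
move=> Hfree HX X7; have X0 : X != set0 by rewrite -card_gt0; move: X7; clear; lia.
have [s6|ns] := boolP (split6 X H); first exact: Or32.
have [k [e [eH ed em om]]] := maximum_matching HX.
have /andP[t1 t2] := threshold_ge X7.
have [k2|k1] := ltnP 1 k; last first.
  have HI : intersecting H.
    move=> g h gH hH; have [i mi] := em g gH.
    have all_own f : f \in H -> f \in own H e i.
      have uniq_i (j : 'I_k) : j = i.
        apply: val_inj; have := ltn_ord i; have := ltn_ord j; move: k1 => /=; clear.
        by move: (val i) (val j) => a b /=; lia.
      move=> fH; have [j mj] := em f fH; apply/ownP; rewrite -(uniq_i j); split=> // l.
      by rewrite (uniq_i l) (uniq_i j) eqxx.
    by apply: om; apply: all_own.
  (* Seven points are separate because the general bound 21 exceeds [threshold 7 = 20]. *)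
  have [X_7|X_8] := leqP #|X| 7.
    have XE : #|X| = 7 by move: X7 X_7; clear; lia.
    by apply: Or33; apply: leq_trans (intersecting7 HX HI XE) (leq_trans _ t2).
  have [|[x P]|le] := intersecting_star_or HX HI; first by move: X_8; clear; lia.
    by apply: Or31; apply: star_near_star P.
  apply: Or33; apply: leq_trans le _; rewrite geq_max.
  have -> : 21 <= threshold #|X|.
    have : all (fun n => 21 <= threshold n) (iota 8 8) by vm_compute.
    by move=> /allP; apply; rewrite mem_iota; move: X7 X_8; clear; lia.
  by move: t1; clear; lia.
have [k3|k_2] : 2 < k \/ k = 2 by move: k2; clear; lia.
  by apply: Or33; exact: (le_threshold_many Hfree HX eH ed em om X7 ns k3).
(* With two matching edges, a vertex of large degree has to be excluded before the capped count
   [two_numeric] can be used from 14 points on. *)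
have [/andP[X14 /existsP[x /andP[xX deg]]]|small] := boolP
  ((14 <= #|X|) && [exists x, (x \in X) && (3 * #|X| - 6 < #|[set h in H | x \in h]|)]).
  have [Y1|Y2] := leqP #|[set h in H | x \notin h]| 1; first by apply: Or31; exists x.
  by apply: Or33; apply: large_degree_le Y2; rewrite ?X14 //; case/andP: X7.
have deg : 14 <= #|X| -> forall x, #|[set h in H | x \in h]| <= 3 * #|X| - 6.
  move=> X14 x; rewrite leqNgt; apply: contra small => big.
  rewrite X14; apply/existsP; exists x; rewrite big andbT.
  have /card_gt0P[h /setIdP[hH xh]] : 0 < #|[set h in H | x \in h]| by apply: leq_trans big.
  by have [_] := triplesP HX hH; apply.
apply: Or33; have [/existsP[i /existsP[h /andP[ho thick]]]|thin] := boolP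
  [exists i, exists h, (h \in own H e i) && (1 < #|h :&: outside X e|)].
  exact: (le_threshold_thick Hfree HX eH ed em om X7 k_2 ho thick deg).
apply: (le_threshold_thin Hfree HX eH ed em om X7 ns k_2) => i h ho.
rewrite leqNgt; apply: contra thin => thick.
by apply/existsP; exists i; apply/existsP; exists h; rewrite ho.
Qed.
End Classification.

(** * Covering all triples *)

Section Covering.
Variable T : finType.
Implicit Types (X V W : {set T}) (H : {set {set T}}).

Lemma split6_le X H b : pfree H -> H \subset triples X -> split6 X H ->
  (forall (Z : {set T}) (G : {set {set T}}), #|Z| = #|X| - 6 -> pfree G -> G \subset triples Z -> #|G| <= b) ->
  #|H| <= 20 + b.
Proof.
move=> Hfree HX /existsP[W /and3P[WX /eqP W6 /forall_inP sp]] P.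
apply: (@leq_trans (#|triples W| + #|[set h in H | [disjoint h & W]]|)).
  apply: card_setU_le; apply/subsetP => h hH; rewrite in_setU in_triples.
  have [h3 hX] := triplesP HX hH; rewrite h3 eqxx andbT.
  by case/orP: (sp h hH) => [->//|d]; apply/orP; right; apply/setIdP.
rewrite card_triples W6 leq_add2l; apply: (P (X :\: W)).
- by rewrite cardsD (setIidPr WX) W6.
- by apply: pfreeS Hfree; apply/subsetP => h /setIdP[].
apply/subsetP => h /setIdP[hH d]; have [h3 hX] := triplesP HX hH.
rewrite in_triples h3 eqxx andbT; apply/subsetP => v vh.
by rewrite inE hX // (disjointFr d vh).
Qed.

Lemma near_star_le X H : H \subset triples X -> near_star X H ->
  #|H| <= 'C(#|X|.-1, 2) + 1.
Proof.
move=> HX [x xX x1].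
apply: (@leq_trans (#|[set h in H | x \in h]| + #|[set h in H | x \notin h]|)).
  by apply: card_setU_le; apply/subsetP => h hH; rewrite !inE hH; case: (x \in h).
apply: leq_add x1; apply: card_star_le xX _; last by move=> h /setIdP[].
by apply: subset_trans HX; apply/subsetP => h /setIdP[].
Qed.

Lemma split6_le_choose X H : pfree H -> H \subset triples X -> split6 X H ->
  #|H| <= 20 + 'C(#|X| - 6, 3).
Proof.
move=> Hfree HX s6; apply: split6_le Hfree HX s6 _ => Z G <- _ GZ.
by rewrite -card_triples; apply: subset_leq_card.
Qed.

(** Up to six points all triples are allowed. The entries 20, 24, 29 are the largest of the three
    alternatives of the classification: 20 from a 6-set, 24 from [threshold 8], and 29 from a
    near-star on 9 points. *)
Lemma pfree_le X H m : pfree H -> H \subset triples X -> #|X| = m -> m <= 9 ->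
  #|H| <= nth 0 [:: 0; 0; 0; 1; 4; 10; 20; 20; 24; 29] m.
Proof.
move=> Hfree HX Xm m9; have [m6|m7] := leqP m 6.
  have := subset_leq_card HX; rewrite card_triples Xm.
  by move: m m6 {m9 Xm} => [|[|[|[|[|[|[|//]]]]]]].
have X7 : 7 <= #|X| <= 15 by rewrite Xm m7 (leq_trans m9).
have [ns|s6|le] := pfree_classification Hfree HX X7.
- have := near_star_le HX ns; rewrite Xm => le; apply: leq_trans le _.
  by move: m m7 m9 {Xm} => [|[|[|[|[|[|[|[|[|[|]]]]]]]]]].
- have := split6_le_choose Hfree HX s6; rewrite Xm => le; apply: leq_trans le _.
  by move: m m7 m9 {Xm} => [|[|[|[|[|[|[|[|[|[|]]]]]]]]]].
rewrite Xm in le; apply: leq_trans le _.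
by move: m m7 m9 {Xm} => [|[|[|[|[|[|[|[|[|[|]]]]]]]]]].
Qed.

(** A split system has at most 20 edges inside the 6-set and a path-free system on the rest. At 12
    points this allows 20 + 20, which is above [threshold 12 = 32]. *)
Lemma split6_le_threshold X H : pfree H -> H \subset triples X -> split6 X H ->
  7 <= #|X| <= 15 -> #|X| != 12 -> #|H| <= threshold #|X|.
Proof.
move=> Hfree HX s6 X7 X12.
pose ex m := nth 0 [:: 0; 0; 0; 1; 4; 10; 20; 20; 24; 29] m.
apply: (@leq_trans (20 + ex (#|X| - 6))).
  apply: split6_le Hfree HX s6 _ => Z G ZX Gfree GZ; apply: pfree_le ZX _ => //.
  by move: X7; clear; lia.
have : all (fun n => (n != 12) ==> (20 + ex (n - 6) <= threshold n)) (iota 7 9) by vm_compute.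
by move=> /allP/(_ #|X|); rewrite mem_iota X12; apply.
Qed.

(* Six balanced bipartitions of twelve points.  If no triple through [v] were
   split by all of them, the sets [S x] of bipartitions not separating [v] from [x]
   would be eleven pairwise intersecting subsets of a 6-set, each point lying in
   five of them; then [5 * #|S x| >= 10 + #|S x|] forces [#|S x| >= 3], and
   [11 * 3 > 6 * 5]. *)
Lemma split_by_all_through X (W : 'I_6 -> {set T}) v : #|X| = 12 -> v \in X ->
  (forall i, W i \subset X /\ #|W i| = 6) ->
  exists2 h, h \in triples X & (v \in h) && [forall i, ~~ (h \subset W i) && ~~ [disjoint h & W i]].
Proof.
move=> X12 vX PW; pose S x := [set i : 'I_6 | (x \in W i) == (v \in W i)].
pose X' := X :\ v; have X'11 : #|X'| = 11 by have := X12; rewrite (cardsD1 v) vX add1n => -[].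
have agree i : #|[set x in X' | i \in S x]| = 5.
  have [Wi W6] := PW i; have [vi|vi] := boolP (v \in W i).
    have -> : [set x in X' | i \in S x] = W i :\ v.
      apply/setP => x; rewrite !inE vi eqb_id -andbA; congr (_ && _).
      by have [xi|] := boolP (x \in W i); rewrite ?andbF // (subsetP Wi).
    by have := W6; rewrite (cardsD1 v) vi add1n => -[].
  have -> : [set x in X' | i \in S x] = (X :\: W i) :\ v.
    by apply/setP => x; rewrite !inE (negPf vi) eqbF_neg -andbA [(x \in X) && _]andbC.
  have := cardsD1 v (X :\: W i); rewrite cardsD (setIidPr Wi) X12 W6 in_setD vi vX.
  by rewrite add1n => -[].
have sumS (A : {set 'I_6}) : \sum_(x in X') #|A :&: S x| = 5 * #|A|.
  under eq_bigr do rewrite -sum1_card.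
  rewrite (exchange_big_dep (mem A)) /=; last by move=> x i _ /setIP[].
  rewrite mulnC -sum_nat_const; apply: eq_bigr => i iA; apply: etrans (agree i).
  rewrite -sum1_card.
  by apply: eq_bigl => x; rewrite !inE iA.
have [/existsP[x /existsP[y /and4P[xX yX xy /eqP Sxy]]]|nex] := boolP
  [exists x, exists y, [&& x \in X', y \in X', x != y & S x :&: S y == set0]].
  move: xX yX; rewrite !inE => /andP[xv xX] /andP[yv yX].
  exists [set v; x; y].
    rewrite inE; apply/andP; split.
      by apply/subsetP => w; rewrite !inE -orbA => /or3P[] /eqP ->.
    by rewrite setUC cardsU1 cards2 !inE negb_or yv [y == x]eq_sym xy [v == x]eq_sym xv.
  rewrite !inE eqxx /=; apply/forallP => i.
  have := in_set0 i; rewrite -Sxy !inE => /negbT; rewrite negb_and => N.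
  apply/andP; split; apply/negP.
    move=> /subsetP s; move: N; rewrite !s ?inE ?eqxx ?orbT //.
  move=> /disjP d; move: N.
  have [vi xi yi] : [/\ v \notin W i, x \notin W i & y \notin W i].
    by split; apply/negP; apply: d; rewrite !inE eqxx ?orbT.
  by rewrite (negPf vi) (negPf xi) (negPf yi).
have S3 x : x \in X' -> 3 <= #|S x|.
  move=> xX'; have := sumS (S x); rewrite (bigD1 x) //= setIid.
  have : \sum_(y in X' | y != x) 1 <= \sum_(y in X' | y != x) #|S x :&: S y|.
    apply: leq_sum => y /andP[yX' yx]; rewrite card_gt0; apply: contra nex => E.
    by apply/existsP; exists x; apply/existsP; exists y; rewrite xX' yX' eq_sym yx.
  have -> : \sum_(y in X' | y != x) 1 = 10.
    have : \sum_(y in X') 1 = 11 by rewrite sum1_card.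
    by rewrite (bigD1 x) //= add1n => -[].
  by move: (\sum_(_ in _ | _) _) #|S x| => a b; clear; lia.
have := sumS setT; rewrite cardsT card_ord.
have : \sum_(x in X') 3 <= \sum_(x in X') #|setT :&: S x|.
  by apply: leq_sum => x xX'; rewrite setTI S3.
by rewrite sum_nat_const X'11 => le E; rewrite E in le.
Qed.

(** By [split_by_all_through] these triples cover all twelve points, three at a time. *)
Lemma split_by_all_ge4 X (W : 'I_6 -> {set T}) : #|X| = 12 ->
  (forall i, W i \subset X /\ #|W i| = 6) ->
  4 <= #|[set h in triples X | [forall i, ~~ (h \subset W i) && ~~ [disjoint h & W i]]]|.
Proof.
move=> X12 PW; set D := [set h in _ | _].
have : #|X| <= #|cover D|.
  apply/subset_leq_card/subsetP => v vX.
  have [h hX /andP[vh sp]] := split_by_all_through X12 vX PW.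
  by apply/bigcupP; exists h => //; apply/setIdP.
rewrite X12 => le; have := leq_trans le (leq_card_cover D).1.
rewrite (eq_bigr (fun=> 3)) ?sum_nat_const; last by move=> h /setIdP[]; rewrite inE => /andP[_ /eqP].
by move: #|D|; clear; lia.
Qed.

Definition respect X W := [set h in triples X | (h \subset W) || [disjoint h & W]].

Lemma card_respect X W : #|X| = 12 -> W \subset X -> #|W| = 6 -> #|respect X W| <= 40.
Proof.
move=> X12 WX W6; apply: (@leq_trans (#|triples W| + #|triples (X :\: W)|)); last first.
  by rewrite !card_triples cardsD (setIidPr WX) X12 W6.
apply: card_setU_le; apply/subsetP => h /setIdP[]; rewrite inE => /andP[hX h3].
rewrite in_setU !in_triples h3 !andbT => /orP[->//|d]; apply/orP; right.
by rewrite subsetD hX d.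
Qed.

(** Two balanced bipartitions have at least 4 = 40 - 36 respected triples in common. They cut the
    points into cells of sizes a, 6 - a, 6 - a, a: a cell of at least four points contains four
    triples, and otherwise all four cells are triples themselves. *)
Lemma card_respectD X V W : #|X| = 12 -> V \subset X -> #|V| = 6 -> W \subset X -> #|W| = 6 ->
  #|respect X V :\: respect X W| <= 36.
Proof.
move=> X12 VX V6 WX W6.
suff I4 : 4 <= #|respect X V :&: respect X W|.
  rewrite cardsD; have := card_respect X12 VX V6; move: I4; clear; lia.
pose C1 := V :&: W; pose C2 := V :\: W; pose C3 := W :\: V; pose C4 := X :\: (V :|: W).
have c12 : #|C1| + #|C2| = 6 by rewrite cardsID.
have c13 : #|C1| + #|C3| = 6 by rewrite /C1 setIC cardsID.
have cU : #|V :|: W| = 12 - #|C1| by rewrite cardsU V6 W6.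
have c4 : #|C4| = #|C1|.
  rewrite cardsD (setIidPr _) ?subUset ?VX // cU X12 subKn //.
  by move: c12; clear; lia.
have cell (C h : {set T}) : C \subset X -> (C \subset V) || [disjoint C & V] ->
    (C \subset W) || [disjoint C & W] -> h \in triples C ->
    h \in respect X V :&: respect X W.
  move=> CX CV CW; rewrite inE => /andP[hC h3]; rewrite !inE h3 (subset_trans hC CX) /=.
  have st (Z : {set T}) : (C \subset Z) || [disjoint C & Z] -> (h \subset Z) || [disjoint h & Z].
    case/orP => [s|d]; first by rewrite (subset_trans hC s).
    by rewrite (disjointWl hC d) orbT.
  by rewrite !st.
have C1P h : h \in triples C1 -> h \in respect X V :&: respect X W.
  by apply: cell; rewrite ?subsetIl ?subsetIr // (subset_trans (subsetIl _ _)).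
have DD (A B : {set T}) : [disjoint A :\: B & B].
  by apply/disjP => v /setDP[_ /negP].
have C2P h : h \in triples C2 -> h \in respect X V :&: respect X W.
  by apply: cell; [apply: subset_trans VX; apply: subsetDl|rewrite subsetDl|rewrite DD orbT].
have C3P h : h \in triples C3 -> h \in respect X V :&: respect X W.
  by apply: cell; [apply: subset_trans WX; apply: subsetDl|rewrite DD orbT|rewrite subsetDl].
have C4d (Z : {set T}) : Z \subset V :|: W -> (C4 \subset Z) || [disjoint C4 & Z].
  by move=> ZU; apply/orP; right; apply: disjointWr ZU (DD _ _).
have C4P h : h \in triples C4 -> h \in respect X V :&: respect X W.
  by apply: cell; rewrite ?subsetDl ?C4d ?subsetUl ?subsetUr.
have big (C : {set T}) : 4 <= #|C| -> (forall h, h \in triples C -> h \in respect X V :&: respect X W) ->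
    4 <= #|respect X V :&: respect X W|.
  move=> C4' P; apply: leq_trans (subset_leq_card (_ : triples C \subset _)); last exact/subsetP.
  by rewrite card_triples (leq_bin2l 3 C4').
have [a4|a3] := leqP 4 #|C1|; first exact: big C1P.
have [b4|b3] := leqP 4 #|C2|; first exact: big C2P.
have [e1 [e2 e3]] : #|C1| = 3 /\ #|C2| = 3 /\ #|C3| = 3 by move: a3 b3 c12 c13; clear; lia.
have self (C : {set T}) : #|C| = 3 -> C \in triples C by move=> c; rewrite inE subxx c.
have ne (C D : {set T}) : #|C| = 3 -> [disjoint C & D] -> C != D.
  by move=> c d; apply: contraTneq d => <-; rewrite -setI_eq0 setIid -cards_eq0 c.
have U4 : uniq [:: C1; C2; C3; C4].
  rewrite /= !inE !negb_or !ne //; apply/disjP => v; rewrite !inE;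
    by case: (v \in V); case: (v \in W).
have -> : 4 = #|[set C in [:: C1; C2; C3; C4]]| by rewrite cardsE; apply/esym/card_uniqP.
apply/subset_leq_card/subsetP => C; rewrite inE !in_cons in_nil orbF => /or4P[] /eqP ->.
- exact/C1P/self.
- exact/C2P/self.
- exact/C3P/self.
by apply/C4P/self; rewrite c4.
Qed.
End Covering.

(** * Triples left uncovered by r path-free systems *)

Section Uncovered.
Variable T : finType.
Implicit Types (X W : {set T}) (H : {set {set T}}).

Definition uncovered X r (Hs : 'I_r -> {set {set T}}) :=
  [set h in triples X | [forall i, h \notin Hs i]].

Lemma card_bigcup_le (I : finType) (P : pred I) (F : I -> {set {set T}}) :
  #|\bigcup_(i | P i) F i| <= \sum_(i | P i) #|F i|.
Proof.
elim/big_rec2: _ => [|i n A _ le]; first by rewrite cards0.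
by rewrite (leq_trans (card_setU_le (subxx _))) // leq_add2l.
Qed.

Lemma card_triples_le X r (Hs : 'I_r -> {set {set T}}) :
  #|triples X| <= #|uncovered X Hs| + \sum_i #|Hs i|.
Proof.
apply: leq_trans (leq_add (leqnn _) (card_bigcup_le _ _)).
apply: card_setU_le; apply/subsetP => h hX; rewrite in_setU orbC.
have [//|n] := boolP (h \in \bigcup_i Hs i); apply/setIdP; split=> //.
by apply/forallP => i; apply: contra n => hi; apply/bigcupP; exists i.
Qed.

Lemma split6_respect X H : H \subset triples X -> split6 X H ->
  exists W, [/\ W \subset X, #|W| = 6 & H \subset respect X W].
Proof.
move=> /subsetP HX /existsP[W /and3P[WX /eqP W6 /forall_inP sp]]; exists W; split=> //.
by apply/subsetP => h hH; apply/setIdP; rewrite HX ?sp.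
Qed.

(** If all six systems are split, the triples crossing all bipartitions remain. If none is, 220 - 6
    * 32 is ample. In a mixed family a split system accounts for 40, a small one for 32 and each
    other one for at most 36 new triples, and 40 + 32 + 4 * 36 = 216. *)
Lemma uncovered12 X (Hs : 'I_6 -> {set {set T}}) : #|X| = 12 ->
  (forall i, pfree (Hs i) /\ Hs i \subset triples X) ->
  (forall i, split6 X (Hs i) \/ #|Hs i| <= 32) -> 4 <= #|uncovered X Hs|.
Proof.
move=> X12 PH cases; have t220 : #|triples X| = 220 by rewrite card_triples X12.
have [/forallP allsplit|] := boolP [forall i, split6 X (Hs i)].
  have /fin_all_exists[W PW] i := split6_respect (PH i).2 (allsplit i).
  have W6 i : W i \subset X /\ #|W i| = 6 by have [] := PW i.
  apply: leq_trans (split_by_all_ge4 X12 W6) _.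
  apply/subset_leq_card/subsetP => h /setIdP[hX /forallP sp]; apply/setIdP; split=> //.
  apply/forallP => i; apply/negP => hi; have [_ _ /subsetP/(_ h hi)] := PW i.
  by case/setIdP => _; have /andP[/negPf -> /negPf ->] := sp i.
rewrite negb_forall => /existsP[i1 /negPf n1].
have le1 : #|Hs i1| <= 32 by have := cases i1; rewrite n1; case.
have [/existsP[i0 s0]|none] := boolP [exists i, split6 X (Hs i)]; last first.
  have le i : #|Hs i| <= 32.
    by case: (cases i) => // si; case/negP: none; apply/existsP; exists i.
  have := card_triples_le X Hs; rewrite t220.
  have : \sum_i #|Hs i| <= \sum_(i < 6) 32 by apply: leq_sum => i _; apply: le.
  by rewrite sum_nat_const card_ord; clear; lia.
have [W0 [W0X W06 H0]] := split6_respect (PH i0).2 s0.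
set A0 := respect X W0 in H0.
have le i : #|Hs i :\: A0| <= 36.
  case: (cases i) => [si|l]; last first.
    by rewrite (leq_trans (subset_leq_card (subsetDl _ _))) // (leq_trans l).
  have [W [WX W6 HW]] := split6_respect (PH i).2 si.
  by apply: leq_trans (card_respectD X12 WX W6 W0X W06); apply/subset_leq_card/setSD.
have : #|triples X| <= #|uncovered X Hs| + (#|A0| + \sum_(i | i != i0) #|Hs i :\: A0|).
  apply: leq_trans (leq_add (leqnn _) (leq_add (leqnn _) (card_bigcup_le _ _))).
  apply: leq_trans (leq_add (leqnn _) (card_setU_le (subxx _))).
  apply: card_setU_le; apply/subsetP => h hX; rewrite !in_setU.
  have [//|hA] := boolP (h \in A0); first by rewrite orbT.
  have [|n] := boolP [exists i, h \in Hs i]; last first.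
    by apply/orP; left; apply/setIdP; rewrite -negb_exists.
  case/existsP => i hi; apply/orP; right; apply/bigcupP; exists i; last exact/setDP.
  by apply: contraNneq hA => E; apply: (subsetP H0); rewrite -E.
have i10 : i1 != i0 by apply: contraFneq n1 => ->.
rewrite (bigD1 i1) //= t220; have := card_respect X12 W0X W06; rewrite -/A0.
have : #|Hs i1 :\: A0| <= 32 by rewrite (leq_trans (subset_leq_card (subsetDl _ _))).
have : \sum_(i | (i != i0) && (i != i1)) #|Hs i :\: A0| <=
    \sum_(i < 6 | (i != i0) && (i != i1)) 36 by apply: leq_sum => i _; apply: le.
rewrite sum_nat_const.
have -> : #|[pred i | (i != i0) && (i != i1)]| = 4.
  have : #|~: [set i0; i1]| = 4 by rewrite cardsCs setCK cards2 eq_sym i10 card_ord.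
  by apply: etrans; apply: eq_card => i; rewrite !inE negb_or.
by move: (\sum_(_ | _) _) #|A0| #|uncovered _ _| #|Hs i1 :\: A0| => a b c d; clear; lia.
Qed.

Lemma uncovered_ge r X (Hs : 'I_r -> {set {set T}}) : r <= 9 -> #|X| = r + 6 ->
  (forall i, pfree (Hs i) /\ Hs i \subset triples X) -> 10 <= #|uncovered X Hs| + r.
Proof.
elim: r X Hs => [|r IH] X Hs r9 Xr PH.
  have := card_triples_le X Hs; rewrite big_ord0 !addn0 card_triples Xr.
  by apply: leq_trans.
have X7 : 7 <= #|X| <= 15 by rewrite Xr; move: r9; clear; lia.
have [/existsP[i /existsP[x /andP[xX x1]]]|nostar] := boolP [exists i, exists x,
    (x \in X) && (#|[set h in Hs i | x \notin h]| <= 1)].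
  pose Hs' j := [set h in Hs (lift i j) | x \notin h].
  have PD : 10 <= #|uncovered (X :\ x) Hs'| + r.
    apply: IH => [||j]; first exact: ltnW.
      by have := Xr; rewrite (cardsD1 x) xX add1n addSn => -[].
    have [P S] := PH (lift i j); split.
      by apply: pfreeS P; apply/subsetP => h /setIdP[].
    apply/subsetP => h /setIdP[hj xh]; have [h3 hX] := triplesP S hj.
    rewrite in_triples h3 eqxx andbT; apply/subsetP => v vh; rewrite !inE hX // andbT.
    by apply: contraNneq xh => <-.
  (* A triple avoiding [x] that the remaining systems leave uncovered can only be covered by the
     deleted system, through its single edge missing [x]. *)
  have : #|uncovered (X :\ x) Hs'| <= #|uncovered X Hs| + #|[set h in Hs i | x \notin h]|.
    apply: card_setU_le; apply/subsetP => h /setIdP[]; rewrite inE subsetD1.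
    move=> /andP[/andP[hX xh] h3] /forallP P; rewrite in_setU.
    have [hi|hi] := boolP (h \in Hs i); first by apply/orP; right; apply/setIdP.
    apply/orP; left; apply/setIdP; split; first by rewrite inE hX.
    apply/forallP => j; case: (unliftP i j) => [l ->|-> //].
    by have := P l; rewrite inE xh andbT.
  by move: x1 PD; clear; lia.
have classify i : split6 X (Hs i) \/ #|Hs i| <= threshold #|X|.
  have [P S] := PH i; have [[x xX x1]|s6|le] := pfree_classification P S X7; [|by left|by right].
  case/negP: nostar; apply/existsP; exists i; apply/existsP; exists x.
  by rewrite xX.
have [X12|X12] := eqVneq #|X| 12.
  have r5 : r = 5 by move: Xr; rewrite X12; clear; lia.
  subst r; have := uncovered12 X12 PH; rewrite X12 in classify.
  by move=> /(_ classify); clear; lia.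
have le i : #|Hs i| <= threshold #|X|.
  by case: (classify i) => // s6; have [P S] := PH i; apply: split6_le_threshold.
have := card_triples_le X Hs; rewrite card_triples.
have : \sum_i #|Hs i| <= \sum_(i < r.+1) threshold #|X| by apply: leq_sum => i _; apply: le.
rewrite sum_nat_const card_ord.
have : all (fun r => (r != 5) ==>
    (10 + r.+1 * threshold (r.+1 + 6) <= 'C(r.+1 + 6, 3) + r.+1)) (iota 0 9) by vm_compute.
move=> /allP/(_ r); rewrite mem_iota r9 => /(_ isT) /implyP.
have r5 : r != 5 by apply: contraNneq X12 => r5; rewrite Xr r5.
move=> /(_ r5); rewrite Xr.
by move: (\sum_(_ < _) _) #|uncovered _ _| ('C(_, _)) (threshold _) => a b c d; clear; nia.
Qed.

End Uncovered.

(** * The two bounds on the Ramsey number *)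

Lemma in_color_class (V : finType) (G : graph3 V) r (c : coloring G r) i h :
  h \in edges (color_class c i) -> exists2 e : edge_of G, c e = i & h = val e.
Proof. by case/imsetP => e; rewrite inE => /eqP ce ->; exists e. Qed.

Lemma arrows_upper r : r <= 9 -> arrows (r + 6) loose_path r.
Proof.
move=> r9 c; pose Hs i := edges (color_class c i).
have [/existsP[i np]|allfree] := boolP [exists i, ~~ pfree (Hs i)].
  exists i; move: np; rewrite negb_forall_in => /exists_inP[x xi].
  rewrite negb_forall_in => /exists_inP[y yi]; rewrite negb_forall_in => /exists_inP[z zi].
  by rewrite negbK; apply: path_copy.
have PH i : pfree (Hs i) /\ Hs i \subset triples [set: 'I_(r + 6)].
  split; first by move: allfree; rewrite negb_exists => /forallP/(_ i); rewrite negbK.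
  apply/subsetP => h hi; rewrite in_triples subsetT.
  by apply/eqP; apply: edges_card3 hi.
have := uncovered_ge r9 _ PH; rewrite cardsT card_ord => /(_ erefl) un.
have /card_gt0P[h /setIdP[]] : 0 < #|uncovered setT Hs| by move: un r9; clear; lia.
rewrite in_triples subsetT => h3 /forallP P.
have hE : h \in edges (complete3 (r + 6)) by rewrite inE.
have := P (c (exist _ h hE)); case/negP.
by apply/imsetP; exists (exist _ h hE); rewrite ?inE.
Qed.

(** The vertices below [r] are the star centres, and an edge receives the colour of some centre that
    it contains. Edges without a centre get the last colour; if n is at most r + 6, they live on at
    most six vertices. *)
Lemma arrows_lower r n : arrows n loose_path r.+1 -> r + 7 <= n.
Proof.
move=> arr; rewrite leqNgt; apply/negP => nr.
pose c : coloring (complete3 n) r.+1 :=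
  fun e => if [pick v in val e | v < r] is Some v then inord v else ord_max.
have [i [f f_inj copy]] := arr c.
have edge (a b d : nat) : triple a b d \in edges loose_path ->
    exists2 e : edge_of (complete3 n), c e = i & f @: triple a b d = val e.
  by move=> tE; apply: in_color_class; apply: copy.
have t0 : triple 0 1 2 \in edges loose_path by rewrite !inE eqxx.
have t1 : triple 2 3 4 \in edges loose_path by rewrite !inE eqxx orbT.
have t2 : triple 4 5 6 \in edges loose_path by rewrite !inE eqxx !orbT.
have [e0 c0 f0] := edge _ _ _ t0; have [e1 c1 f1] := edge _ _ _ t1.
have [e2 c2 f2] := edge _ _ _ t2.
(* In a star colour all edges contain the same centre, but the two end edges of the path are
   disjoint. *)
have [ir|ri] := ltnP i r.
  have hit e : c e = i -> exists2 v, v \in val e & val v = i.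
    rewrite /c; case: pickP => [v /andP[ve vr] vi|_ E]; last by rewrite -E /= ltnn in ir.
    by exists v => //; rewrite -vi inordK // ltnW.
  have [v0 ve0 vi0] := hit e0 c0; have [v2 ve2 vi2] := hit e2 c2.
  have E : v0 = v2 by apply: val_inj; rewrite /= vi0 vi2.
  move: ve0 ve2; rewrite -f0 -f2 E => /imsetP[a a0 ->] /imsetP[b b2 /f_inj ab].
  by move: a0 b2; rewrite ab !inE -!val_eqE /= !inordK //; clear; lia.
have high e v : c e = i -> v \in val e -> r <= v.
  rewrite /c; case: pickP => [w /andP[we wr] wi _|n0 _ ve].
    have ww : (inord w : 'I_r.+1) = w :> nat by rewrite inordK // ltnW.
    by move: ri; rewrite -wi ww leqNgt wr.
  by have := n0 v; rewrite ve /= ltnNge => /negbFE.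
have fr (a : 'I_7) : r <= f a.
  have at_ (t : {set 'I_7}) (e : edge_of (complete3 n)) : c e = i -> f @: t = val e -> a \in t -> r <= f a.
    by move=> ce ft ta; apply: high ce _; rewrite -ft imset_f.
  have : [|| a \in triple 0 1 2, a \in triple 2 3 4 | a \in triple 4 5 6].
    by clear; case: a => [[|[|[|[|[|[|[|//]]]]]]] ai]; rewrite !inE -!val_eqE /= !inordK.
  by case/or3P; [apply: at_ c0 f0|apply: at_ c1 f1|apply: at_ c2 f2].
(* In the last colour all seven vertices of the copy are at least [r], so shifting by [r] would
   embed them into six points. *)
pose g (a : 'I_7) : 'I_6 := inord (f a - r).
have g_inj : injective g.
  move=> a b; move/(congr1 val); rewrite /= !inordK; first last.
  - by have := ltn_ord (f a); move: nr; clear; lia.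
  - by have := ltn_ord (f b); move: nr; clear; lia.
  move=> E; apply: f_inj; apply: val_inj => /=.
  by rewrite -(subnK (fr a)) E subnK.
by have := leq_card g g_inj; rewrite !card_ord.
Qed.

Theorem theorem2 (r : nat) (hr : 1 <= r <= 9) : is_ramsey loose_path r (r + 6).
Proof.
case/andP: hr; case: r => // r _ r9; split; first exact: arrows_upper.
by move=> n /arrows_lower; rewrite addSn addnS.
Qed.
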